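(* Let $s\ge4$ be an even integer, $\gamma\ge1$, $\sigma\ge\gamma+\frac12$ and $\varepsilon\in(0,1]$. Let $(u^\varepsilon,v^\varepsilon,w^\varepsilon)$ be a smooth solution, defined on $[0,T^\varepsilon]$, of the regularized Prandtl equations (see context). Suppose there is a constant $\delta\in(0,1)$ such that $(1+y)^\sigma w^\varepsilon\ge\delta$ for all $(t,x,y)\in[0,T^\varepsilon]\times\mathbb{T}\times\mathbb{R}^+$. Then, for $t\in[0,T^\varepsilon]$, $$\Omega(t)\le C_{\gamma,\sigma,\delta}\sup_{0\le\tau\le t}\|\partial_x^sU(\tau)\|_{L^\infty(\mathbb{T})}^4+C_{\gamma,\sigma,\delta}\big(1+\Omega_g(t)^2\big)$$ and $$\Omega_g(t)\le C_{\gamma,\sigma,\delta}\big(1+\Omega(t)^2\big),$$ where $\Omega(t):=\sup_{0\le\tau\le t}\|w^\varepsilon(\tau)\|_{\mathcal{B}^{s,\gamma,\sigma}}^2$, $\Omega_g(t):=\sup_{0\le\tau\le t}\|w^\varepsilon(\tau)\|_{\mathcal{B}^{s,\gamma,\sigma}_g}^2$, and the constants depend only on their subscripts.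
   Context: $\mathbb{T}=\mathbb{R}/\mathbb{Z}$, $\mathbb{R}^+=[0,+\infty)$, $D^\alpha=\partial_x^{\alpha_1}\partial_y^{\alpha_2}$; $L^2$, $L^\infty$ without a domain are over $\mathbb{T}\times\mathbb{R}^+$ at a fixed time. Regularized Prandtl equations, for $\varepsilon>0$, a given outer flow $U=U(t,x)$ and initial datum $u_0$: $$\begin{cases}\partial_tu^\varepsilon+u^\varepsilon\partial_xu^\varepsilon+v^\varepsilon\partial_yu^\varepsilon-\varepsilon^2\partial_x^2u^\varepsilon-\partial_y^2u^\varepsilon+\partial_xp^\varepsilon=0,\\ \partial_xu^\varepsilon+\partial_yv^\varepsilon=0,\\ u^\varepsilon|_{t=0}=u_0,\\ u^\varepsilon|_{y=0}=v^\varepsilon|_{y=0}=0,\quad\lim_{y\to+\infty}u^\varepsilon=U(t,x),\end{cases}$$ on $\mathbb{T}\times\mathbb{R}^+$, where $p^\varepsilon=p^\varepsilon(t,x)$ satisfies $\partial_tU+U\partial_xU=\varepsilon^2\partial_x^2U-\partial_xp^\varepsilon$. The vorticity $w^\varepsilon:=\partial_yu^\varepsilon$ then satisfies $$\partial_tw^\varepsilon+u^\varepsilon\partial_xw^\varepsilon+v^\varepsilon\partial_yw^\varepsilon=\varepsilon^2\partial_x^2w^\varepsilon+\partial_y^2w^\varepsilon,\quad w^\varepsilon|_{t=0}=\partial_yu_0,\quad\partial_yw^\varepsilon|_{y=0}=\partial_xp^\varepsilon,$$ with $u^\varepsilon=U-\int_y^{+\infty}w^\varepsilon(t,x,\eta)\,d\eta$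 and $v^\varepsilon=-\int_0^y\partial_xu^\varepsilon(t,x,\eta)\,d\eta$. Norms: $\|w\|_{H^{s,\gamma}}^2:=\sum_{|\alpha|\le s}\|(1+y)^{\gamma+\alpha_2}D^\alpha w\|_{L^2}^2$. With $g_s^\varepsilon:=\partial_x^sw^\varepsilon-\frac{\partial_yw^\varepsilon}{w^\varepsilon}\partial_x^s(u^\varepsilon-U)$, $$\|w^\varepsilon\|_{H^{s,\gamma}_g}^2:=\|(1+y)^\gamma g_s^\varepsilon\|_{L^2}^2+\sum_{\substack{|\alpha|\le s\\ \alpha_1\le s-1}}\|(1+y)^{\gamma+\alpha_2}D^\alpha w^\varepsilon\|_{L^2}^2.$$ With $Q(t):=\sum_{1\le|\alpha|\le2}\|(1+y)^{\sigma+\alpha_2}D^\alpha w^\varepsilon(t)\|_{L^\infty}^2$, set $\|w^\varepsilon(t)\|_{\mathcal{B}^{s,\gamma,\sigma}}^2:=\|w^\varepsilon(t)\|_{H^{s,\gamma}}^2+Q(t)$ and $\|w^\varepsilon(t)\|_{\mathcal{B}^{s,\gamma,\sigma}_g}^2:=\|w^\varepsilon(t)\|_{H^{s,\gamma}_g}^2+Q(t)$. *)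

(* Defs.v *)
From HB Require Import structures.
From mathcomp Require Import all_boot all_order all_algebra.
From mathcomp Require Import all_classical all_reals all_analysis.
Set Implicit Arguments.
Unset Strict Implicit.
Unset Printing Implicit Defensive.
Import Order.TTheory GRing.Theory Num.Theory.
Import numFieldNormedType.Exports.
Local Open Scope ring_scope.
Local Open Scope classical_set_scope.

(* The torus R/Z is encoded by 1-periodic functions of x : R. A field at a fixed
   time is a function w x y, and a time-dependent field is a function w t x y;
   only its values for t in [0, T] and y >= 0 are ever used. *)

Section Derivatives.
Context {R : realType}.
Implicit Types (A : set R) (h : R -> R) (w : R -> R -> R) (f : R -> R -> R -> R).

(* Derivative relative to A: the usual one at interior points of A, the
   one-sided one at the end points of an interval. *)
Definition derivable_on A h (a : R) : Prop :=
  cvg ((h z - h a) / (z - a) @[z --> within A a^']).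

Definition derive_on A h (a : R) : R :=
  lim ((h z - h a) / (z - a) @[z --> within A a^']).

Definition pdx w : R -> R -> R := fun x y => derive1 (w ^~ y) x.
Definition pdy w : R -> R -> R := fun x y => derive_on `[0, +oo[ (w x) y.

Definition D (a1 a2 : nat) w : R -> R -> R := iter a1 pdx (iter a2 pdy w).

Definition dt (T : R) f : R -> R -> R -> R :=
  fun t x y => derive_on `[0, T] (fun t' => f t' x y) t.
Definition dx f : R -> R -> R -> R := fun t => pdx (f t).
Definition dy f : R -> R -> R -> R := fun t => pdy (f t).

Definition spacetime (T : R) : set (R * R * R) :=
  [set z | [/\ 0 <= z.1.1, z.1.1 <= T & 0 <= z.2]].

(* C^n on [0, T] x R x [0, +oo[, up to the boundary: all iterated partial
   derivatives of order at most n, in any order of differentiation, exist and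
   are jointly continuous. *)
Fixpoint Cn (T : R) (n : nat) f : Prop :=
  {within spacetime T, continuous (fun z : R * R * R => f z.1.1 z.1.2 z.2)} /\
  if n is m.+1 then
    (forall t x y : R, 0 <= t <= T -> 0 <= y ->
      [/\ derivable_on `[0, T] (fun t' => f t' x y) t,
          derivable (fun x' => f t x' y) x 1 &
          derivable_on `[0, +oo[ (f t x) y]) /\
    [/\ Cn T m (dt T f), Cn T m (dx f) & Cn T m (dy f)]
  else True.

Definition smooth (T : R) f : Prop := forall n, Cn T n f.

Definition periodic f (T : R) : Prop :=
  forall t x y : R, 0 <= t <= T -> 0 <= y -> f t (x + 1) y = f t x y.

End Derivatives.

Section Prandtl.
Context {R : realType}.

(* Functions of (t, x) are seen as fields that do not depend on y. *)
Definition lift_tx (U : R -> R -> R) : R -> R -> R -> R := fun t x _ => U t x.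

Record prandtl_solution (eps T : R) (U : R -> R -> R) (u0 : R -> R -> R)
    (p : R -> R -> R) (u v : R -> R -> R -> R) : Prop := PrandtlSolution {
  outer_smooth : smooth T (lift_tx U) ;
  outer_periodic : periodic (lift_tx U) T ;
  pressure_derivable : forall t x : R, 0 <= t <= T -> derivable (p t) x 1 ;
  pressure_periodic : periodic (lift_tx p) T ;
  u_smooth : smooth T u ;
  u_periodic : periodic u T ;
  v_smooth : smooth T v ;
  v_periodic : periodic v T ;
  bernoulli : forall t x : R, 0 <= t <= T ->
    derive_on `[0, T] (U ^~ x) t + U t x * derive1 (U t) x
    = eps ^+ 2 * derive1n 2 (U t) x - derive1 (p t) x ;
  momentum : forall t x y : R, 0 <= t <= T -> 0 <= y ->
    dt T u t x y + u t x y * dx u t x y + v t x y * dy u t x y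
    - eps ^+ 2 * dx (dx u) t x y - dy (dy u) t x y + derive1 (p t) x = 0 ;
  incompressible : forall t x y : R, 0 <= t <= T -> 0 <= y ->
    dx u t x y + dy v t x y = 0 ;
  initial : forall x y : R, 0 <= y -> u 0 x y = u0 x y ;
  u_no_slip : forall t x : R, 0 <= t <= T -> u t x 0 = 0 ;
  v_no_slip : forall t x : R, 0 <= t <= T -> v t x 0 = 0 ;
  u_far_field : forall t x : R, 0 <= t <= T -> u t x y @[y --> +oo] --> U t x
}.

Definition vorticity (u : R -> R -> R -> R) : R -> R -> R -> R := dy u.

End Prandtl.

Section Norms.
Context {R : realType}.
Implicit Types (w u : R -> R -> R) (U : R -> R).
Local Open Scope ereal_scope.

Definition half_strip : set (R * R) := `[0%R, 1%R[ `*` `[0%R, +oo[.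

(* Norms on T x R+ and on T, taken on the extension by zero of the
   restriction to a period. *)
Definition normLp (q : \bar R) w : \bar R :=
  'N[(@lebesgue_measure R \x @lebesgue_measure R)]_q
    [EFin \o ((fun z : R * R => w z.1 z.2) \_ half_strip)].

Definition normLoo_torus U : \bar R :=
  'N[@lebesgue_measure R]_+oo [EFin \o (U \_ `[0%R, 1%R[)].

Definition weighted (k : R) w : R -> R -> R :=
  fun x y => ((1 + y) `^ k * w x y)%R.

Definition Hsqr (s : nat) (gamma : R) w : \bar R :=
  \sum_(a : 'I_s.+1 * 'I_s.+1 | (a.1 + a.2 <= s)%N)
    normLp 2%:E (weighted (gamma + a.2%:R) (D a.1 a.2 w)) ^+ 2.

Definition good_unknown (s : nat) U u w : R -> R -> R :=
  fun x y => (D s 0 w x y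
    - pdy w x y / w x y * D s 0 (fun x' y' => u x' y' - U x') x y)%R.

Definition Hgsqr (s : nat) (gamma : R) U u w : \bar R :=
  normLp 2%:E (weighted gamma (good_unknown s U u w)) ^+ 2
  + \sum_(a : 'I_s.+1 * 'I_s.+1 | (a.1 + a.2 <= s)%N && (a.1 <= s - 1)%N)
      normLp 2%:E (weighted (gamma + a.2%:R) (D a.1 a.2 w)) ^+ 2.

Definition Q (sigma : R) w : \bar R :=
  \sum_(a : 'I_3 * 'I_3 | (1 <= a.1 + a.2 <= 2)%N)
    normLp +oo (weighted (sigma + a.2%:R) (D a.1 a.2 w)) ^+ 2.

Definition Bsqr (s : nat) (gamma sigma : R) w : \bar R :=
  Hsqr s gamma w + Q sigma w.

Definition Bgsqr (s : nat) (gamma sigma : R) U u w : \bar R :=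
  Hgsqr s gamma U u w + Q sigma w.

Definition sup_upto (t : R) (F : R -> \bar R) : \bar R :=
  ereal_sup [set F tau | tau in `[0%R, t]].

Definition Omega (s : nat) (gamma sigma : R) (w : R -> R -> R -> R) (t : R) :
    \bar R :=
  sup_upto t (fun tau => Bsqr s gamma sigma (w tau)).

Definition Omega_g (s : nat) (gamma sigma : R) (U : R -> R -> R)
    (u w : R -> R -> R -> R) (t : R) : \bar R :=
  sup_upto t (fun tau => Bgsqr s gamma sigma (U tau) (u tau) (w tau)).

End Norms.

(* Main.v *)
Require Import Defs.
From HB Require Import structures.
From mathcomp Require Import all_boot all_order all_algebra.
From mathcomp Require Import all_classical all_reals all_analysis.
From mathcomp Require Import measurable_realfun ess_sup_inf ring lra.
Import Order.TTheory GRing.Theory Num.Theory.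
Import numFieldNormedType.Exports.
Local Open Scope ring_scope.
Local Open Scope classical_set_scope.

(* Write F = d_x^s (u - U), b = d_x^s w, g = b - (w_y / w) F = w d_y (F / w), and
   q for the weighted L^oo norm of w_y, so q^2 <= Q. Since |w_y / w| <=
   q / (delta (1 + y)) the second inequality reduces to the Hardy inequality
   || (1 + y)^(gamma-1) F || <= C || (1 + y)^gamma b ||, which needs F -> 0 as
   y -> oo. Only u - U -> 0 is given, but for fixed z an s-fold integration by
   parts on the torus gives
   int F(x,z) F(x,y) dx = +- int d_x^(2s) (u - U)(x,z) (u - U)(x,y) dx -> 0
   (0 <= u <= U because w > 0), which is enough.
   For the first inequality write b = g + w_y h with h = F / w. Pairing h with
   w_y directly costs a single factor q, and as gamma - 1 - sigma <= -3/2 the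
   Hardy inequality with data at y = 0 bounds || (1 + y)^(gamma-1-sigma) h || by
   || (1 + y)^(gamma-sigma) g / w || and by h(x,0) = - d_x^s U / w(x,0). *)

(** * One-sided and mixed derivatives *)

(** The pairing [F(z) F(Y)] tends to 0 in mean over x for each fixed z, with no uniformity in z, so
    the boundary term [F(z)^2] of a Hardy argument cannot be sent to 0 directly. On [0, z] that
    term, weighted by [(1 + z)^n], is traded for [(1 + z)^n F(z) F(Y)] plus a weighted integral of
    [b^2] over [z, Y]; then Y goes to infinity with z fixed, and z only afterwards, by monotone
    convergence. The two thresholds are those of the two Hardy inequalities: the one at infinity has
    exponent [n = 2 gamma - 1] and asks for [1 <= n], the one at the wall has exponent
    [m = 2 sigma - 2 gamma + 1] and asks for [2 <= m]. The comparison is quadratic because a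
    top-order square is multiplied by [q^2 <= Q], and both factors belong to the same energy. The
    fourth power of [d_x^s U] comes from splitting [Q V^2], with [V] its sup norm, into [Q^2] and
    [V^4]. All energies live in the extended reals: a finite [q] is extracted only once the energy
    on the right is known to be finite. *)

Lemma within_dnbhs_quotient {R : realType} (A : set R) (h : R -> R) (a : R) :
  nbhs a A ->
  ((h z - h a) / (z - a) @[z --> within A a^']) =
  ((h (k + a) - h a) / k @[k --> 0^']).
Proof.
move=> Aa; rewrite predeqE => P; split.
- rewrite /nbhs/= /within/= => H.
  have {H} : \forall z \near a^', P ((h z - h a) / (z - a)).
    have Aa' : a^' A by apply: nbhs_dnbhs.
    apply: (filterS2 _ _ H Aa') => z; exact.
  move=> [e /= e0 H]; exists e => //= k; rewrite /ball_/= sub0r normrN => ke k0.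
  have := H (k + a); rewrite /ball_/= addrK; apply.
    by rewrite opprD addrCA subrr addr0 normrN.
  by rewrite -subr_eq0 addrK.
- move=> [e /= e0 H]; rewrite /nbhs/= /within/=.
  exists e => //= z; rewrite /ball_/= => ze za _.
  have := H (z - a); rewrite /ball_/= sub0r normrN distrC subr_eq0 subrK.
  by move=> Hz; exact: (Hz ze za).
Qed.

Lemma derive_on_nbhs {R : realType} (A : set R) (h : R -> R) (a : R) :
  nbhs a A -> derive_on A h a = derive1 h a.
Proof.
move=> Aa; rewrite /derive_on (within_dnbhs_quotient _ _ _ Aa) /derive1.
suff -> : (fun k => (h (k + a) - h a) / k) =
  (fun k => k^-1 *: (h (k + a) - h a)) by [].
by apply/funext => k; rewrite mulrC.
Qed.

Lemma derivable_on_nbhs {R : realType} (A : set R) (h : R -> R) (a : R) :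
  nbhs a A -> derivable_on A h a -> derivable h a 1.
Proof.
move=> Aa; rewrite /derivable_on (within_dnbhs_quotient _ _ _ Aa).
have E : (fun k => (h (k + a) - h a) / k) =
    (fun k => k^-1 *: ((h \o shift a) (k *: 1) - h a)).
  by apply/funext => k /=; rewrite /GRing.scale/= mulr1 mulrC.
by rewrite E; apply.
Qed.

Lemma is_derive_derive1 {R : realType} (h : R -> R) (a : R) :
  derivable h a 1 -> is_derive a 1 h (derive1 h a).
Proof. by move=> dh; rewrite derive1E; exact: derivableP. Qed.

(** Interior points of the half-line see the one-sided derivative as an ordinary one. This is why
    every later derivative in y is taken at [0 < y], and the wall is reached by continuity only. *)
Lemma pdy_is_derive {R : realType} (f : R -> R -> R) (x y : R) : 0 < y ->
  derivable_on `[0, +oo[ (f x) y -> is_derive y 1 (f x) (pdy f x y).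
Proof.
move=> y0 df.
have Iy : nbhs y (`[0, +oo[ : set R).
  have : nbhs y (`]0, +oo[ : set R).
    by apply: open_nbhs_nbhs; split; [exact: interval_open|rewrite /= in_itv/= y0].
  by apply: filterS => z /=; rewrite !in_itv/= !andbT => /ltW.
rewrite /pdy (derive_on_nbhs _ _ _ Iy); apply: is_derive_derive1.
exact: (derivable_on_nbhs _ _ _ Iy df).
Qed.

Lemma is_derive_continuous {R : realType} (g : R -> R) (dg a : R) :
  is_derive a 1 g dg -> {for a, continuous g}.
Proof.
move=> D; apply: differentiable_continuous; apply/derivable1_diffP.
exact: ex_derive.
Qed.

Lemma MVT_closed {R : realType} (g dg : R -> R) (z h : R) : 0 < h ->
  (forall c, c \in `[z, (z + h)]%R -> is_derive c 1 g (dg c)) ->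
  exists2 c, c \in `[z, (z + h)]%R & g (z + h) - g z = dg c * h.
Proof.
move=> h0 D.
have zh : z < z + h by rewrite ltrDl.
have C : {within `[z, (z + h)], continuous g}.
  apply: derivable_within_continuous => c cz.
  exact: (@ex_derive _ _ _ _ _ _ _ (D c cz)).
have D' c : c \in `]z, (z + h)[%R -> is_derive c 1 g (dg c).
  by move=> cz; apply: D; apply: subset_itv_oo_cc cz.
have [c cz ->] := MVT zh D' C.
exists c; first exact: subset_itv_oo_cc cz.
by congr (_ * _); rewrite addrC addKr.
Qed.

(* Clairaut: the increment over the square [x, x + h] x [y, y + h] divided by
   h^2 is a value of either mixed derivative nearby. *)
Lemma mixed_derivatives_eq {R : realType} (f fx fy fxy fyx : R -> R -> R)
    (x y : R) (e : R) : 0 < e ->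
  (forall a b, `|a - x| < e -> `|b - y| < e ->
     [/\ is_derive a 1 (f ^~ b) (fx a b), is_derive b 1 (f a) (fy a b),
         is_derive b 1 (fx a) (fxy a b) & is_derive a 1 (fy ^~ b) (fyx a b)]) ->
  {for (x, y), continuous (fun z : R * R => fxy z.1 z.2)} ->
  {for (x, y), continuous (fun z : R * R => fyx z.1 z.2)} ->
  fxy x y = fyx x y.
Proof.
move=> e0 df cxy cyx; apply/eqP; rewrite -subr_eq0 -normr_le0.
apply/ler_addgt0Pl => r r0; rewrite addr0.
have r20 : 0 < r / 2 by rewrite divr_gt0.
have /cvgrPdist_le /(_ _ r20) [[A B] /= [[a a0 Aa] [b b0 Bb]] H1] := cxy.
have /cvgrPdist_le /(_ _ r20) [[A' B'] /= [[a' a'0 Aa'] [b' b'0 Bb']] H2] := cyx.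
pose m := Num.min e (Num.min (Num.min a b) (Num.min a' b')).
have m0 : 0 < m by rewrite /m !lt_min e0 a0 b0 a'0 b'0.
(* Half of the common radius keeps the closed square of side [h] inside the open neighbourhoods. *)
pose h := m / 2.
have h0 : 0 < h by rewrite divr_gt0.
have hm : h < m by rewrite ltr_pdivrMr// ltr_pMr// ltr1n.
have I z c : c \in `[z, (z + h)]%R -> `|c - z| < m.
  rewrite in_itv/= => /andP[zc cz].
  by rewrite ger0_norm ?subr_ge0// (le_lt_trans _ hm)// lerBlDl.
have Ie z c : c \in `[z, (z + h)]%R -> `|c - z| < e.
  by move=> /I /lt_le_trans; apply; rewrite /m ge_min lexx.
have lc z : z \in `[z, (z + h)]%R by rewrite bound_itvE lerDl ltW.
have rc z : z + h \in `[z, (z + h)]%R by rewrite bound_itvE lerDl ltW.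
have [c cI E1] : exists2 c, c \in `[x, (x + h)]%R &
    (f (x + h) (y + h) - f (x + h) y) - (f x (y + h) - f x y)
    = (fx c (y + h) - fx c y) * h.
  apply: (@MVT_closed _ (fun c => f c (y + h) - f c y)
    (fun c => fx c (y + h) - fx c y) x h h0) => c cI.
  have [d1 _ _ _] := df c (y + h) (Ie _ _ cI) (Ie _ _ (rc y)).
  have [d2 _ _ _] := df c y (Ie _ _ cI) (Ie _ _ (lc y)).
  exact: is_deriveB.
have [d dI E2] : exists2 d, d \in `[y, (y + h)]%R &
    fx c (y + h) - fx c y = fxy c d * h.
  apply: (@MVT_closed _ (fx c) (fxy c) y h h0) => d dI.
  by have [] := df c d (Ie _ _ cI) (Ie _ _ dI).
have [d' dI' E1'] : exists2 d, d \in `[y, (y + h)]%R &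
    (f (x + h) (y + h) - f x (y + h)) - (f (x + h) y - f x y)
    = (fy (x + h) d - fy x d) * h.
  apply: (@MVT_closed _ (fun d => f (x + h) d - f x d)
    (fun d => fy (x + h) d - fy x d) y h h0) => d' dI'.
  have [_ d1 _ _] := df (x + h) d' (Ie _ _ (rc x)) (Ie _ _ dI').
  have [_ d2 _ _] := df x d' (Ie _ _ (lc x)) (Ie _ _ dI').
  exact: is_deriveB.
have [c' cI' E2'] : exists2 c, c \in `[x, (x + h)]%R &
    fy (x + h) d' - fy x d' = fyx c d' * h.
  apply: (@MVT_closed _ (fy ^~ d') (fyx ^~ d') x h h0) => c' cI'.
  by have [] := df c' d' (Ie _ _ cI') (Ie _ _ dI').
have E : fxy c d = fyx c' d'.
  have hh : h * h != 0 by rewrite mulf_neq0// gt_eqF.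
  apply: (mulIf hh).
  rewrite mulrA -E2 -E1 mulrA -E2' -E1'; ring.
have mle : [/\ m <= a, m <= b, m <= a' & m <= b'].
  by rewrite /m !ge_min !lexx !orbT.
have [ma mb ma' mb'] := mle.
have N1 : `|fxy x y - fxy c d| <= r / 2.
  apply: (H1 (c, d)); split => /=.
    by apply: Aa; rewrite /ball_/= distrC (lt_le_trans (I _ _ cI)).
  by apply: Bb; rewrite /ball_/= distrC (lt_le_trans (I _ _ dI)).
have N2 : `|fyx x y - fyx c' d'| <= r / 2.
  apply: (H2 (c', d')); split => /=.
    by apply: Aa'; rewrite /ball_/= distrC (lt_le_trans (I _ _ cI')).
  by apply: Bb'; rewrite /ball_/= distrC (lt_le_trans (I _ _ dI')).
have -> : fxy x y - fyx x y = (fxy x y - fxy c d) - (fyx x y - fyx c' d').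
  rewrite E; ring.
by rewrite (le_trans (ler_normB _ _))// (le_trans (lerD N1 N2))// -splitr.
Qed.

(** * Continuity, measurability and Tonelli on the half-plane *)

(* Continuity on the closed half-plane y >= 0, as continuity of the even
   extension in y to the whole plane. *)
Definition cts {R : realType} (f : R -> R -> R) : Prop :=
  continuous (fun z : R * R => f z.1 `|z.2|).

Lemma ctsD {R : realType} (f g : R -> R -> R) :
  cts f -> cts g -> cts (fun x y => f x y + g x y).
Proof. by move=> cf cg z; apply: continuousD; [exact: cf|exact: cg]. Qed.

Lemma ctsB {R : realType} (f g : R -> R -> R) :
  cts f -> cts g -> cts (fun x y => f x y - g x y).
Proof. by move=> cf cg z; apply: continuousB; [exact: cf|exact: cg]. Qed.

Lemma ctsM {R : realType} (f g : R -> R -> R) :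
  cts f -> cts g -> cts (fun x y => f x y * g x y).
Proof. by move=> cf cg z; apply: continuousM; [exact: cf|exact: cg]. Qed.

Lemma ctsX {R : realType} (n : nat) (f : R -> R -> R) :
  cts f -> cts (fun x y => f x y ^+ n).
Proof.
move=> cf z.
apply: (@continuous_comp _ _ _ (fun z : R * R => f z.1 `|z.2|)
  (fun t : R => t ^+ n)); [exact: cf|exact: exprn_continuous].
Qed.

Lemma ctsV {R : realType} (f : R -> R -> R) :
  (forall x y, 0 <= y -> f x y != 0) -> cts f -> cts (fun x y => (f x y)^-1).
Proof. by move=> f0 cf z; apply: continuousV; [exact: f0|exact: cf]. Qed.

Lemma cts_fst {R : realType} (g : R -> R) :
  continuous g -> cts (fun x _ => g x).
Proof.
by move=> cg z; apply: (@continuous_comp _ _ _ fst g); [exact: cvg_fst|exact: cg].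
Qed.

Lemma cts_cst {R : realType} (c : R) : cts (fun _ _ => c).
Proof. by apply: cts_fst => x; exact: cvg_cst. Qed.

Lemma cts_snd {R : realType} (g : R -> R) :
  (forall y, 0 <= y -> {for y, continuous g}) -> cts (fun _ y => g y).
Proof.
move=> cg z; apply: (@continuous_comp _ _ _ (fun z : R * R => `|z.2|) g).
  apply: (@continuous_comp _ _ _ snd (@Num.norm R R)); first exact: cvg_snd.
  exact: norm_continuous.
exact: cg.
Qed.

Lemma cts_weight {R : realType} (k : R) : cts (fun _ y => (1 + y) `^ k).
Proof.
apply: cts_snd => y y0.
apply: (@continuous_comp _ _ _ (fun y : R => 1 + y) (@powR R ^~ k)).
  by apply: continuousD; [exact: cvg_cst|exact: cvg_id].
have : 0 < 1 + y by rewrite ltr_pwDl.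
by move=> /(is_derive1_powR k) /is_derive_continuous.
Qed.

Lemma pairl_continuous {R : realType} (x : R) : continuous (fun y : R => (x, y)).
Proof.
move=> y; apply: (@cvg_pair _ _ _ (nbhs y) (nbhs x) (nbhs y) _ _ _ (fun=> x) id).
  exact: cvg_cst.
exact: cvg_id.
Qed.

Lemma pairr_continuous {R : realType} (y : R) : continuous (fun x : R => (x, y)).
Proof.
move=> x; apply: (@cvg_pair _ _ _ (nbhs x) (nbhs x) (nbhs y) _ _ _ id (fun=> y)).
  exact: cvg_id.
exact: cvg_cst.
Qed.

Lemma cts_slice_y {R : realType} (f : R -> R -> R) (x : R) :
  cts f -> continuous (fun y : R => f x `|y|).
Proof.
move=> cf y.
apply: (@continuous_comp R (R * R)%type R (fun y : R => (x, y))
  (fun z : R * R => f z.1 `|z.2|)).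
  exact: pairl_continuous.
exact: cf.
Qed.

Lemma cts_slice_x {R : realType} (f : R -> R -> R) (y : R) :
  0 <= y -> cts f -> continuous (f ^~ y).
Proof.
move=> y0 cf x.
have E : (f ^~ y) = (fun z : R * R => f z.1 `|z.2|) \o (fun x => (x, y)).
  by apply/funext => x' /=; rewrite ger0_norm.
rewrite E; apply: (@continuous_comp R (R * R)%type R (fun x : R => (x, y))
  (fun z : R * R => f z.1 `|z.2|)).
  exact: pairr_continuous.
exact: cf.
Qed.

(** The plane carries the product sigma-algebra, so an open set has to be exhibited as a countable
    union of rectangles: the squares with rational centre and half-side [1/(n+1)] that it
    contains. *)
Lemma open_measurable_plane {R : realType} (U : set (R * R)) : open U ->
  measurable (U : set (measurableTypeR R * measurableTypeR R)).
Proof.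
move=> oU.
pose I (p : rat) (n : nat) : set R :=
  `](ratr p - n.+1%:R^-1), (ratr p + n.+1%:R^-1)[.
pose B p q n : set (R * R) := if `[< I p n `*` I q n `<=` U >] then I p n `*` I q n else set0.
have -> : U = \bigcup_p \bigcup_q \bigcup_n B p q n.
  apply/seteqP; split=> [[a b] Uab|z [p _ [q _ [n _]]]]; last first.
    by rewrite /B; case: ifPn => // /asboolP; apply.
  have := open_nbhs_nbhs (conj oU Uab).
  move=> [[X Y] /= [[e e0 Xe] [d d0 Yd]] XY].
  have m0 : 0 < Num.min e d by rewrite lt_min e0 d0.
  (* A point of the square is within [1/(n+1)] of the rational centre, which is itself within
     [1/(n+1)] of [a] (resp. [b]); the two errors must add up to less than the radius. *)
  have [n nm] : exists n : nat, n.+1%:R^-1 < Num.min e d / 2.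
    exists (Num.truncn (Num.min e d / 2)^-1).
    rewrite invf_plt ?posrE ?divr_gt0//.
    exact: truncnS_gt.
  have n0 : 0 < n.+1%:R^-1 :> R by rewrite invr_gt0.
  have oB (c : R) : open (ball c (n.+1%:R^-1 : R)) by exact: ball_open.
  have nB (c : R) : ball c (n.+1%:R^-1 : R) c by exact: ballxx.
  have [r1 [/= pa [p _ pE]]] := @dense_rat R (ball a n.+1%:R^-1)
     (ex_intro _ _ (nB a)) (oB a).
  have [r2 [/= qb [q _ qE]]] := @dense_rat R (ball b n.+1%:R^-1)
     (ex_intro _ _ (nB b)) (oB b).
  have near_I (r : rat) (c c' : R) : ball c (n.+1%:R^-1 : R) (ratr r : R) -> I r n c' ->
      `|c - c'| < Num.min e d.
    rewrite /ball/= /I/= in_itv/= => crn /andP[l1 l2].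
    have -> : c - c' = (c - ratr r) + (ratr r - c') by ring.
    apply: (le_lt_trans (ler_normD _ _)).
    rewrite (splitr (Num.min e d)); apply: ltrD; apply: (lt_trans _ nm) => //.
    rewrite ltr_norml; move: l1 l2; set t := _^-1 => l1 l2.
    by apply/andP; split; lra.
  rewrite -pE in pa; rewrite -qE in qb.
  exists p => //; exists q => //; exists n => //.
  rewrite /B; case: asboolP => [_|]; last first.
    case=> -[a' b'] [/= pa' qb']; apply: XY; split => /=.
      apply: Xe; rewrite /ball_/=.
      apply: (lt_le_trans (near_I p _ _ _ pa')); last by rewrite ge_min lexx.
      exact: pa.
    apply: Yd; rewrite /ball_/=.
    apply: (lt_le_trans (near_I q _ _ _ qb')); last by rewrite ge_min lexx orbT.
    exact: qb.
  split; rewrite /I/= in_itv/=.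
    move: pa; rewrite /ball/= ltr_norml; set t := _^-1 => /andP[? ?].
    by apply/andP; split; lra.
  move: qb; rewrite /ball/= ltr_norml; set t := _^-1 => /andP[? ?].
  by apply/andP; split; lra.
apply: bigcupT_measurable_rat => p; apply: bigcupT_measurable_rat => q.
apply: bigcupT_measurable => n; rewrite /B; case: ifPn => // _.
by apply: measurableX; exact: measurable_itv.
Qed.

Lemma continuous_measurable_plane {R : realType} (f : R * R -> R) :
  continuous f ->
  measurable_fun [set: measurableTypeR R * measurableTypeR R] f.
Proof.
move=> /continuousP cf.
apply: (measurability _ (RGenOpens.measurableE R)).
move=> _ [_ [a [b ->] <-]]; rewrite setTI.
by apply: open_measurable_plane; apply: cf; exact: interval_open.
Qed.

Lemma cts_measurable {R : realType} (f : R -> R -> R) (A B : set R) :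
  measurable (A : set (measurableTypeR R)) ->
  measurable (B : set (measurableTypeR R)) ->
  B `<=` `[0, +oo[ -> cts f ->
  measurable_fun (A `*` B : set (measurableTypeR R * measurableTypeR R))
    (fun z : R * R => f z.1 z.2).
Proof.
move=> mA mB B0 cf.
apply: (eq_measurable_fun (fun z : R * R => f z.1 `|z.2|)).
  move=> z /[!inE] -[_ /B0] /=; rewrite in_itv/= andbT => z0.
  by rewrite ger0_norm.
apply: (measurable_funS measurableT) => //.
exact: continuous_measurable_plane cf.
Qed.

Section tonelli.
Context {R : realType}.
Local Notation mu := (@lebesgue_measure R).
Variables (f : R -> R -> R) (A B : set R).
Hypotheses (mA : measurable (A : set (measurableTypeR R)))
  (mB : measurable (B : set (measurableTypeR R))) (B0 : B `<=` `[0, +oo[)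
  (cf : cts f) (f0 : forall x y, 0 <= y -> 0 <= f x y).
Local Open Scope ereal_scope.

(** Extension by zero reduces Tonelli on the rectangle [A x B] to Tonelli on the whole plane; [FE]
    identifies the inner integral of the extension. *)
Let fr : measurableTypeR R * measurableTypeR R -> \bar R :=
  (EFin \o (fun z : R * R => f z.1 z.2)) \_ (A `*` B).

Let mfr : measurable_fun [set: measurableTypeR R * measurableTypeR R] fr.
Proof.
apply/(measurable_restrictT _ _).1; first exact: measurableX.
by apply/measurable_EFinP; exact: cts_measurable.
Qed.

Let fr0 z : 0 <= fr z.
Proof.
apply: erestrict_ge0 => {}z [_ /B0] /=; rewrite in_itv/= andbT => z0.
by rewrite lee_fin; exact: f0.
Qed.

Let FE : fubini_F mu fr = (fun x => \int[mu]_(y in B) (f x y)%:E) \_ A.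
Proof.
apply/funext => x; rewrite /fubini_F patchE; case: ifPn => xA.
  rewrite [RHS]integral_mkcond; apply: eq_integral => y _.
  rewrite /fr !patchE; congr (if _ then _ else _).
  by rewrite in_setX xA.
apply: integral0_eq => y _; rewrite /fr patchE.
by rewrite in_setX (negbTE xA).
Qed.

Lemma tonelli_cts :
  \int[mu \x mu]_(z in A `*` B) (f z.1 z.2)%:E =
  \int[mu]_(x in A) \int[mu]_(y in B) (f x y)%:E.
Proof.
rewrite integral_mkcond (@fubini_tonelli1 _ _ _ _ R mu mu fr mfr fr0) FE.
by rewrite [RHS]integral_mkcond.
Qed.

Lemma measurable_partial_integral :
  measurable_fun A (fun x => \int[mu]_(y in B) (f x y)%:E).
Proof.
apply/(measurable_restrictT _ mA); rewrite -FE.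
exact: measurable_fun_fubini_tonelli_F.
Qed.

End tonelli.

(** * Hardy inequalities *)

(** Monotone convergence along the slabs of height n. The Hardy arguments thus only handle integrals
    of continuous functions over compact intervals in y. *)
Lemma strip_int_le_slabs {R : realType} (P : R -> R -> R) (M : \bar R) :
  cts P -> (forall x y, 0 <= y -> 0 <= P x y) ->
  (forall n : nat,
    \int[@lebesgue_measure R]_(x in `[0%R, 1%R[)
      \int[@lebesgue_measure R]_(y in `[0%R, n%:R]) (P x y)%:E <= M)%E ->
  (\int[(@lebesgue_measure R \x @lebesgue_measure R)]_(z in half_strip)
     (P z.1 z.2)%:E <= M)%E.
Proof.
move=> cP P0 H.
pose F (n : nat) : set (measurableTypeR R * measurableTypeR R) :=
  `[0%R, 1%R[ `*` `[0%R, n%:R].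
have sub n : `[0%R, n%:R] `<=` (`[0%R, +oo[ : set R).
  by move=> y /=; rewrite !in_itv/= andbT => /andP[].
have mF n : measurable (F n).
  by apply: measurableX; exact: measurable_itv.
have -> : half_strip = \bigcup_n F n.
  apply/seteqP; split=> [[x y] [/= xI]|[x y] [n _ [/= xI yI]]]; last first.
    by split => //=; exact: sub yI.
  rewrite in_itv/= andbT => y0; exists (Num.truncn y).+1 => //; split => //=.
  by rewrite in_itv/= y0/= ltW// truncnS_gt.
apply: (@cvge_le _ \oo _ R (fun n => \int[(@lebesgue_measure R \x @lebesgue_measure R)]_(z in F n)
     (P z.1 z.2)%:E)%E).
  by apply: nearW => n; rewrite tonelli_cts.
apply: (@ge0_nondecreasing_set_cvg_integral _
  (measurableTypeR R * measurableTypeR R)%type R F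
  (fun z => (P z.1 z.2)%:E) (@lebesgue_measure R \x @lebesgue_measure R)%E).
- move=> n m nm; apply/subsetPset => -[x y] [/= xI yI]; split => //=.
  move: yI; rewrite !in_itv/= => /andP[-> /le_trans]; apply.
  by rewrite ler_nat.
- exact: mF.
- by move=> n; apply/measurable_EFinP; exact: cts_measurable.
- by move=> n [x y] [/= _ /sub]/=; rewrite in_itv/= andbT lee_fin => /P0.
Qed.

(** The common core of the Hardy inequalities: integrate [P + K' <= Q] and use the fundamental
    theorem of calculus for the potential [K]. Continuity is asked of the even extensions, which
    makes sense on both sides of y = 0, and the derivative only beyond [a], since at the wall it is
    merely one-sided. *)
Lemma integral_le_of_derive_le {R : realType} (P Q K k : R -> R) (a b : R) : 0 <= a -> a <= b ->
  continuous (fun y : R => P `|y|) -> continuous (fun y : R => Q `|y|) ->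
  continuous (fun y : R => k `|y|) -> continuous (fun y : R => K `|y|) ->
  (forall y, a < y -> is_derive y 1 K (k y)) ->
  (forall y, a <= y -> P y + k y <= Q y) ->
  (\int[@lebesgue_measure R]_(y in `[a, b]) (P y)%:E + (K b)%:E <=
   (K a)%:E + \int[@lebesgue_measure R]_(y in `[a, b]) (Q y)%:E)%E.
Proof.
move=> a0 ab cP cQ ck cK dK H.
have [->|neab] := eqVneq a b; first by rewrite !set_itv1 !integral_set1 adde0 add0e.
have {neab}ab : a < b by rewrite lt_neqAle neab.
have I (f : R -> R) : continuous (fun y : R => f `|y|) ->
    (@lebesgue_measure R).-integrable `[a, b] (EFin \o f).
  move=> cf.
  apply: (@eq_integrable _ (measurableTypeR R) R _ `[a, b] _
    (EFin \o (fun y : R => f `|y|))) => //.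
    move=> y; rewrite inE/= in_itv/= => /andP[ay _].
    by rewrite ger0_norm// (le_trans a0).
  apply: continuous_compact_integrable; first exact: segment_compact.
  by apply: continuous_subspaceT.
have Ik : (\int[@lebesgue_measure R]_(y in `[a, b]) (k `|y|)%:E
    = (K b)%:E - (K a)%:E)%E.
  apply: continuous_FTC2 => //.
  - exact: continuous_subspaceT.
  - split.
    + by move=> y; rewrite in_itv/= => /andP[/dK []].
    + have := cK a; rewrite /continuous_at ger0_norm// => /cvg_at_right_filter.
      apply: cvg_trans; apply: near_eq_cvg; near=> y.
      by rewrite ger0_norm// (le_trans a0)//; apply: ltW; near: y; exact: nbhs_right_gt.
    + have b0 : 0 <= b by rewrite (le_trans a0)// ltW.
      have := cK b; rewrite /continuous_at ger0_norm// => /cvg_at_left_filter.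
      apply: cvg_trans; apply: near_eq_cvg; near=> y.
      rewrite ger0_norm// (le_trans a0)//; apply: ltW; near: y.
      exact: nbhs_left_gt.
  - move=> y; rewrite in_itv/= => /andP[ay _].
    have [_ E] := dK _ ay.
    by rewrite derive1E E ger0_norm// ltW// (le_lt_trans a0).
have : (\int[@lebesgue_measure R]_(y in `[a, b]) (P y + k y)%:E <=
        \int[@lebesgue_measure R]_(y in `[a, b]) (Q y)%:E)%E.
  apply: le_integral => //.
  - apply: (I (fun y => P y + k y)) => y; apply: continuousD; [exact: cP|exact: ck].
  - exact: I.
  - by move=> y; rewrite inE/= in_itv/= lee_fin => /andP[ay _]; exact: H.
under eq_integral do rewrite EFinD.
rewrite integralD//=; [|exact: I|exact: I].
have -> : (\int[@lebesgue_measure R]_(y in `[a, b]) (k y)%:E =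
           \int[@lebesgue_measure R]_(y in `[a, b]) (k `|y|)%:E)%E.
  apply: eq_integral => y; rewrite inE/= in_itv/= => /andP[ay _].
  by rewrite ger0_norm// (le_trans a0).
rewrite Ik => le1.
move: le1 => /(leeD2l (K a)%:E); apply: le_trans.
have /fineK <- : (\int[@lebesgue_measure R]_(y in `[a, b]) (P y)%:E)%E
    \is a fin_num by apply: integrable_fin_num => //; exact: I.
by rewrite -EFinB -!EFinD lee_fin; lra.
Unshelve. all: by end_near. Qed.

Local Notation leb := (@lebesgue_measure _).
Local Notation strip_int f :=
  (\int[(@lebesgue_measure _ \x @lebesgue_measure _)%E]_(z in half_strip)
     (f z.1 z.2)%:E)%E.

Lemma is_derive_add {R : realType} (f g : R -> R) (a df dg : R) :
  is_derive a 1 f df -> is_derive a 1 g dg ->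
  is_derive a 1 (fun y => f y + g y) (df + dg).
Proof. exact: is_deriveD. Qed.

Lemma is_derive_mul {R : realType} (f g : R -> R) (a df dg : R) :
  is_derive a 1 f df -> is_derive a 1 g dg ->
  is_derive a 1 (fun y => f y * g y) (f a * dg + g a * df).
Proof. exact: is_deriveM. Qed.

Lemma is_derive_sqr {R : realType} (f : R -> R) (a df : R) :
  is_derive a 1 f df -> is_derive a 1 (fun y => f y ^+ 2) (2 * f a * df).
Proof. by move=> D; have := is_deriveX 2 D; rewrite expr1. Qed.

Lemma is_derive_scale {R : realType} (c : R) (f : R -> R) (a df : R) :
  is_derive a 1 f df -> is_derive a 1 (fun y => c * f y) (c * df).
Proof. exact: is_deriveZ. Qed.

Lemma is_derive_weight {R : realType} (k y : R) : 0 < y ->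
  is_derive y 1 (fun y : R => (1 + y) `^ k) (k * (1 + y) `^ (k - 1)).
Proof.
move=> y0.
have Y : 0 < 1 + y by rewrite addr_gt0.
have D1 : is_derive y 1 (fun y : R => 1 + y) (0 + 1).
  exact: (is_derive_add _ _ _ _ _ (is_derive_cst (1 : R) y 1) (is_derive_id y 1)).
have := @is_derive1_comp _ (@powR R ^~ k) _ _ _ _ (is_derive1_powR k Y) D1.
by rewrite add0r mulr1.
Qed.

Lemma weightS {R : realType} (k y : R) : 0 <= y ->
  (1 + y) `^ (k + 1) = (1 + y) `^ k * (1 + y).
Proof.
move=> y0; have Y : 0 < 1 + y by rewrite ltr_pwDl.
by rewrite powRD ?(gt_eqF Y) ?implybT// powRr1// ltW.
Qed.

Lemma subset_segment_ray {R : realType} (a b : R) : 0 <= a ->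
  `[a, b] `<=` (`[0, +oo[ : set R).
Proof.
by move=> a0 y /=; rewrite !in_itv/= andbT => /andP[/(le_trans a0)].
Qed.

Lemma cts_measurable_slice {R : realType} (f : R -> R -> R) (x : R) (B : set R) :
  measurable (B : set (measurableTypeR R)) -> B `<=` `[0, +oo[ -> cts f ->
  measurable_fun (B : set (measurableTypeR R)) (fun y => (f x y)%:E).
Proof.
move=> mB B0 cf; apply/measurable_EFinP.
apply: (eq_measurable_fun (fun y : R => f x `|y|)).
  by move=> y /[!inE] /B0 /=; rewrite in_itv/= andbT => y0; rewrite ger0_norm.
apply: (measurable_funS measurableT) => //.
by apply: continuous_measurable_fun; exact: cts_slice_y.
Qed.

(* Integrate d/dy ((1 + y)^-m h^2): the cross term is absorbed by the square of
   h - (1 + y) k. *)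
Lemma hardy_pointwise_zero {R : realType} (m : R) (h k : R -> R -> R) (x z : R) :
  2 <= m -> 0 <= z -> cts h -> cts k ->
  (forall x y : R, 0 < y -> is_derive y 1 (h x) (k x y)) ->
  (\int[leb]_(y in `[0%R, z]) ((1 + y) `^ (- m - 1) * h x y ^+ 2)%:E <=
   (h x 0 ^+ 2)%:E +
   \int[leb]_(y in `[0%R, z]) ((1 + y) `^ (1 - m) * k x y ^+ 2)%:E)%E.
Proof.
move=> m2 z0 ch ck dh.
pose P x y := (1 + y) `^ (- m - 1) * h x y ^+ 2.
pose Q x y := (1 + y) `^ (1 - m) * k x y ^+ 2.
pose K x y := (1 + y) `^ (- m) * h x y ^+ 2.
pose K' x y := - m * (1 + y) `^ (- m - 1) * h x y ^+ 2 +
   (1 + y) `^ (- m) * (2 * h x y * k x y).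
have cP : cts P by apply: ctsM; [exact: cts_weight|exact: ctsX].
have cQ : cts Q by apply: ctsM; [exact: cts_weight|exact: ctsX].
have cK : cts K by apply: ctsM; [exact: cts_weight|exact: ctsX].
have cK' : cts K'.
  apply: ctsD; apply: ctsM => //.
  - by apply: ctsM; [exact: cts_cst|exact: cts_weight].
  - exact: ctsX.
  - exact: cts_weight.
  - by apply: ctsM => //; apply: ctsM => //; exact: cts_cst.
have dK (y : R) : 0 < y -> is_derive y 1 (K x) (K' x y).
  move=> y0; have D1 := @is_derive_weight R (- m) y y0.
  have D2 := is_derive_sqr _ _ _ (dh x y y0).
  by apply: (is_derive_eq (is_derive_mul _ _ _ _ _ D1 D2)); rewrite /K'; ring.
have : (\int[leb]_(y in `[0%R, z]) (P x y)%:E + (K x z)%:E <=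
   (K x 0)%:E + \int[leb]_(y in `[0%R, z]) (Q x y)%:E)%E.
  apply: (@integral_le_of_derive_le R (P x) (Q x) (K x) (K' x)) => //; try exact: cts_slice_y.
  move=> y y0; have y1 : 0 < 1 + y by rewrite ltr_pwDl.
  have E2 : (1 + y) `^ (- m) = (1 + y) `^ (- m - 1) * (1 + y).
    by rewrite -weightS// subrK.
  have E1 : (1 + y) `^ (1 - m) = (1 + y) `^ (- m - 1) * (1 + y) * (1 + y).
    by rewrite -E2 -weightS// (addrC 1 (- m)).
  have t0 : 0 <= (1 + y) `^ (- m - 1) by exact: powR_ge0.
  rewrite -subr_ge0 /P /Q /K' E1 E2.
  set t := (1 + y) `^ _ in t0 *; set s := 1 + y.
  (* Completing the square leaves exactly [(m - 2) h^2]; this is where [2 <= m] enters. *)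
  rewrite [leRHS](_ : _ = t * ((m - 2) * h x y ^+ 2 + (h x y - s * k x y) ^+ 2)).
    by rewrite mulr_ge0// addr_ge0 ?sqr_ge0// mulr_ge0 ?sqr_ge0// subr_ge0.
  by ring.
(* The weight is 1 at the wall, so [K x 0] is the boundary datum [h(x,0)^2]; the nonnegative [K x z]
   is dropped. *)
rewrite {2}/K addr0 powR1 mul1r; apply: le_trans.
by rewrite leeDl// lee_fin mulr_ge0 ?sqr_ge0 ?powR_ge0.
Qed.

Lemma hardy_zero {R : realType} (m : R) (h k : R -> R -> R) :
  2 <= m -> cts h -> cts k ->
  (forall x y : R, 0 < y -> is_derive y 1 (h x) (k x y)) ->
  (strip_int (fun x y => (1 + y) `^ (- m - 1) * h x y ^+ 2)%R <=
   \int[leb]_(x in `[0%R, 1%R[) (h x 0 ^+ 2)%:E +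
   strip_int (fun x y => (1 + y) `^ (1 - m) * k x y ^+ 2)%R)%E.
Proof.
move=> m2 ch ck dh.
have cw r (f : R -> R -> R) : cts f -> cts (fun x y => (1 + y) `^ r * f x y ^+ 2).
  by move=> cf; apply: ctsM; [exact: cts_weight|exact: ctsX].
have w0 r (f : R -> R -> R) x y : 0 <= (1 + y) `^ r * f x y ^+ 2.
  by rewrite mulr_ge0 ?sqr_ge0 ?powR_ge0.
have mh : measurable_fun (`[0, 1[ : set (measurableTypeR R)) (fun x => (h x 0 ^+ 2)%:E).
  apply/measurable_EFinP; apply: measurable_funX; apply: measurable_funS measurableT _ _ => //.
  by apply: continuous_measurable_fun; exact: cts_slice_x.
apply: (strip_int_le_slabs _ _ (cw _ _ ch)) => // n.
rewrite /half_strip (tonelli_cts (fun x y => (1 + y) `^ (1 - m) * k x y ^+ 2))//; last exact: cw.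
rewrite -ge0_integralD//=.
- apply: ge0_le_integral => //=.
  + by move=> x _; apply: integral_ge0 => y _; rewrite lee_fin.
  + apply: (measurable_partial_integral (fun x y => (1 + y) `^ (- m - 1) * h x y ^+ 2)) => //.
      exact: subset_segment_ray.
    exact: cw.
  + apply: emeasurable_funD => //.
    apply: (measurable_partial_integral (fun x y => (1 + y) `^ (1 - m) * k x y ^+ 2)) => //.
    exact: cw.
  + move=> x _; apply: (le_trans (hardy_pointwise_zero _ _ _ _ _ m2 _ ch ck dh)) => //.
    rewrite leeD2l//; apply: ge0_subset_integral => //=.
    * by apply: (cts_measurable_slice (fun x y => (1 + y) `^ (1 - m) * k x y ^+ 2)) => //; exact: cw.
    * by move=> y _; rewrite lee_fin.
    * exact: subset_segment_ray.
- by move=> x _; rewrite lee_fin sqr_ge0.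
- by move=> x _; apply: integral_ge0 => y _; rewrite lee_fin.
- apply: (measurable_partial_integral (fun x y => (1 + y) `^ (1 - m) * k x y ^+ 2)) => //.
  exact: cw.
Qed.

(** Boundary terms are real while the integrals may be infinite; [a] can change sides because it is
    finite. *)
Lemma lee_shift {R : realType} (I X Y : \bar R) (a b c : R) :
  (I + a%:E <= b%:E + X)%E -> (X <= Y)%E -> b - a <= c -> (I <= c%:E + Y)%E.
Proof.
rewrite -leeBrDr// => /le_trans IX XY bac; apply: IX.
by rewrite addeAC -EFinB leeD ?lee_fin.
Qed.

(* The term F(z) F(Y) takes the place of the boundary condition F(oo) = 0: its
   x-integral vanishes as Y -> oo. *)
Lemma hardy_pointwise_infty {R : realType} (n : R) (F b : R -> R -> R) (x z Y : R) :
  1 <= n -> 0 <= z -> z <= Y -> cts F -> cts b ->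
  (forall x y : R, 0 < y -> is_derive y 1 (F x) (b x y)) ->
  (\int[leb]_(y in `[0%R, z]) ((1 + y) `^ (n - 1) * F x y ^+ 2)%:E <=
   (4 * (1 + z) `^ n * (F x z * F x Y))%:E +
   6%:E * \int[leb]_(y in `[0%R, +oo[) ((1 + y) `^ (n + 1) * b x y ^+ 2)%:E)%E.
Proof.
move=> n1 z0 zY cF cb dF.
pose P x y := (1 + y) `^ (n - 1) * F x y ^+ 2.
pose q x y := (1 + y) `^ (n + 1) * b x y ^+ 2.
have cP : cts P by apply: ctsM; [exact: cts_weight|exact: ctsX].
have cq : cts q by apply: ctsM; [exact: cts_weight|exact: ctsX].
have q0 x' y : 0 <= q x' y by rewrite mulr_ge0 ?sqr_ge0 ?powR_ge0.
set J := (\int[leb]_(y in `[0%R, +oo[) _)%E.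
have sub c a d : 0 <= c -> 0 <= a ->
    (\int[leb]_(y in `[a, d]) (c * q x y)%:E <= c%:E * J)%E.
  move=> c0 a0.
  have mq (B : set R) : measurable (B : set (measurableTypeR R)) ->
      B `<=` `[0, +oo[ -> measurable_fun (B : set (measurableTypeR R)) (fun y => (q x y)%:E).
    by move=> mB B0; exact: cts_measurable_slice.
  under eq_integral do rewrite EFinM.
  rewrite ge0_integralZl//=.
  - rewrite lee_wpmul2l ?lee_fin//; apply: ge0_subset_integral => //=.
    + exact: mq.
    + by move=> y _; rewrite lee_fin; exact: q0.
    + exact: subset_segment_ray.
  - by apply: mq => //; exact: subset_segment_ray.
  - by move=> y _; rewrite lee_fin; exact: q0.
(* The usual Hardy computation on [0, z] with potential [-2 (1 + y)^n F^2]: its value at 0 has the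
   favourable sign, and its value at z is the boundary term that [above] has to absorb. *)
have below : (\int[leb]_(y in `[0%R, z]) (P x y)%:E <=
    (2 * (1 + z) `^ n * F x z ^+ 2)%:E + 4%:E * J)%E.
  pose K (x y : R) := - 2 * ((1 + y) `^ n * F x y ^+ 2).
  pose K' (x y : R) := - 2 * ((1 + y) `^ n * (2 * F x y * b x y) +
    F x y ^+ 2 * (n * (1 + y) `^ (n - 1))).
  have dK (y : R) : 0 < y -> is_derive y 1 (K x) (K' x y).
    move=> y0; apply: is_derive_scale.
    exact: is_derive_mul (@is_derive_weight R n y y0) (is_derive_sqr _ _ _ (dF x y y0)).
  have cK : cts K.
    by apply: ctsM (cts_cst _) (ctsM _ _ (cts_weight _) (ctsX _ _ cF)).
  have cK' : cts K'.
    apply: ctsM (cts_cst _) _; apply: ctsD; apply: ctsM.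
    - exact: cts_weight.
    - by apply: ctsM => //; apply: ctsM => //; exact: cts_cst.
    - exact: ctsX.
    - by apply: ctsM; [exact: cts_cst|exact: cts_weight].
  have := @integral_le_of_derive_le R (P x) (fun y => 4 * q x y) (K x) (K' x) 0 z (lexx _) z0
    (cts_slice_y _ x cP) (cts_slice_y _ x (ctsM _ _ (cts_cst 4) cq))
    (cts_slice_y _ x cK') (cts_slice_y _ x cK) dK.
  have PQ y : 0 <= y -> P x y + K' x y <= 4 * q x y.
    move=> y0; rewrite -subr_ge0 /P /q /K'.
    have -> : (1 + y) `^ (n + 1) = (1 + y) `^ (n - 1) * (1 + y) * (1 + y).
      by rewrite -weightS// subrK -weightS.
    have -> : (1 + y) `^ n = (1 + y) `^ (n - 1) * (1 + y).
      by rewrite -weightS// subrK.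
    have t0 : 0 <= (1 + y) `^ (n - 1) by exact: powR_ge0.
    set t := (1 + y) `^ _ in t0 *; set s := 1 + y.
    rewrite [leRHS](_ : _ = t * ((2 * (n - 1)) * F x y ^+ 2
      + (F x y + 2 * s * b x y) ^+ 2)).
      by rewrite mulr_ge0// addr_ge0 ?sqr_ge0// mulr_ge0 ?sqr_ge0// mulr_ge0// subr_ge0.
    by ring.
  move=> /(_ PQ) le1.
  apply: (lee_shift _ _ _ _ _ _ le1); first exact: sub.
  rewrite /K -subr_ge0 addr0 powR1.
  rewrite [leRHS](_ : _ = 2 * F x 0 ^+ 2); first by rewrite mulr_ge0 ?sqr_ge0.
  by ring.
(* Write [F(Y) = F(z) + int_z^Y b] and split [4 A F(z) b] by Young between [2 (1 + y)^(n+1) b^2] and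
   [2 A^2 F(z)^2 (1 + y)^(-n-1)]. Since [1 <= n], the last term integrates over [z, Y] to at most
   [2 A^2 F(z)^2 (1 + z)^(-n) = 2 A F(z)^2], half of [4 A F(z)^2]. The second summand of [K] encodes
   this integral. *)
have above : ((2 * (1 + z) `^ n * F x z ^+ 2)%:E <=
    (4 * (1 + z) `^ n * (F x z * F x Y))%:E + 2%:E * J)%E.
  pose A := (1 + z) `^ n.
  pose K (x y : R) := - 4 * A * F x z * F x y + (2 * A ^+ 2 * F x z ^+ 2) * (1 + y) `^ (- n).
  pose K' (x y : R) := - 4 * A * F x z * b x y +
    (2 * A ^+ 2 * F x z ^+ 2) * (- n * (1 + y) `^ (- n - 1)).
  have dK (y : R) : z < y -> is_derive y 1 (K x) (K' x y).
    move=> zy; have y0 : 0 < y by exact: le_lt_trans zy.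
    apply: is_derive_add; apply: is_derive_scale; first exact: dF.
    exact: is_derive_weight.
  have cFz : cts (fun x _ => F x z) by apply: cts_fst; exact: cts_slice_x.
  have cK : cts K.
    apply: ctsD; apply: ctsM => //.
    - by apply: ctsM => //; exact: cts_cst.
    - by apply: ctsM; [exact: cts_cst|exact: ctsX].
    - exact: cts_weight.
  have cK' : cts K'.
    apply: ctsD; apply: ctsM => //.
    - by apply: ctsM => //; exact: cts_cst.
    - by apply: ctsM; [exact: cts_cst|exact: ctsX].
    - by apply: ctsM; [exact: cts_cst|exact: cts_weight].
  have := @integral_le_of_derive_le R (fun=> 0) (fun y => 2 * q x y) (K x) (K' x) z Y z0 zY
    (cts_slice_y _ x (cts_cst 0)) (cts_slice_y _ x (ctsM _ _ (cts_cst 2) cq))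
    (cts_slice_y _ x cK') (cts_slice_y _ x cK) dK.
  have PQ y : z <= y -> 0 + K' x y <= 2 * q x y.
    move=> zy; have y0 : 0 <= y by exact: le_trans zy.
    rewrite -subr_ge0 add0r /q /K'.
    have -> : - n - 1 = - (n + 1) by ring.
    rewrite powRN.
    have t0 : 0 < (1 + y) `^ (n + 1) by rewrite powR_gt0// ltr_pwDl.
    set t := (1 + y) `^ _ in t0 *.
    rewrite [leRHS](_ : _ = 2 * t^-1 * ((n - 1) * (A * F x z) ^+ 2
      + (A * F x z + t * b x y) ^+ 2)).
      apply: mulr_ge0; first by rewrite mulr_ge0// invr_ge0 ltW.
      by rewrite addr_ge0 ?sqr_ge0// mulr_ge0 ?sqr_ge0// subr_ge0.
    by field; rewrite gt_eqF.
  move=> /(_ PQ); rewrite integral0_eq// add0e => le1.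
  apply: (lee_shift _ (\int[leb]_(y in `[z, Y]) (2 * q x y)%:E)%E _
    (K x Y - 2 * A * F x z ^+ 2) (K x z)); last first.
  - have Az : A * (1 + z) `^ (- n) = 1.
      by rewrite powRN divff// gt_eqF// powR_gt0// ltr_pwDl.
    rewrite -subr_ge0 /K.
    rewrite [leRHS](_ : _ = 2 * A ^+ 2 * F x z ^+ 2 * (1 + Y) `^ (- n)
      + 2 * A * F x z ^+ 2 * (1 - A * (1 + z) `^ (- n))).
      by rewrite Az subrr mulr0 addr0 mulr_ge0 ?powR_ge0// mulr_ge0 ?sqr_ge0// mulr_ge0 ?sqr_ge0.
    by rewrite -/A; ring.
  - exact: sub.
  - by rewrite -EFinD addrC subrK.
apply: (le_trans below).
have J0 : (0 <= J)%E by apply: integral_ge0 => y _; rewrite lee_fin; exact: q0.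
apply: (le_trans (leeD2r _ above)).
rewrite -addeA leeD2l// -ge0_muleDl ?lee_fin// -EFinD lee_wpmul2r// lee_fin.
lra.
Qed.

Lemma unit_integrable {R : realType} (f : R -> R) : continuous f ->
  (@lebesgue_measure R).-integrable `[0, 1[ (EFin \o f).
Proof.
move=> cf; apply: (@integrableS _ (measurableTypeR R) R _ `[0, 1]) => //.
  by move=> x /=; rewrite !in_itv/= => /andP[-> /ltW].
apply: continuous_compact_integrable; first exact: segment_compact.
exact: continuous_subspaceT.
Qed.

Lemma continuous_mul {R : realType} (f g : R -> R) :
  continuous f -> continuous g -> continuous (fun x => f x * g x).
Proof. by move=> cf cg x; apply: continuousM; [exact: cf|exact: cg]. Qed.

Lemma continuous_add {R : realType} (f g : R -> R) :
  continuous f -> continuous g -> continuous (fun x => f x + g x).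
Proof. by move=> cf cg x; apply: continuousD; [exact: cf|exact: cg]. Qed.

(** For a slab of fixed height m the pointwise inequality is integrated in x and its cross term
    disappears as N grows. What remains, [6 J] with 6 = 4 + 2 from the two pieces of the pointwise
    bound, does not depend on m. *)
Lemma hardy_infty {R : realType} (n : R) (F b : R -> R -> R) :
  1 <= n -> cts F -> cts b ->
  (forall x y : R, 0 < y -> is_derive y 1 (F x) (b x y)) ->
  (forall z : R, 0 <= z ->
    (\int[leb]_(x in `[0%R, 1%R[) (F x z * F x N%:R)%:E)%E @[N --> \oo]
      --> 0%E) ->
  (strip_int (fun x y => (1 + y) `^ (n - 1) * F x y ^+ 2)%R <=
   6%:E * strip_int (fun x y => (1 + y) `^ (n + 1) * b x y ^+ 2)%R)%E.
Proof.
move=> n1 cF cb dF decay.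
have cw r (f : R -> R -> R) : cts f -> cts (fun x y => (1 + y) `^ r * f x y ^+ 2).
  by move=> cf; apply: ctsM; [exact: cts_weight|exact: ctsX].
have w0 r (f : R -> R -> R) x y : 0 <= (1 + y) `^ r * f x y ^+ 2.
  by rewrite mulr_ge0 ?sqr_ge0 ?powR_ge0.
set J := (X in (_ <= _ * X)%E).
have J0 : (0 <= J)%E by apply: integral_ge0 => z _; rewrite lee_fin; exact: w0.
(* Finiteness of [J] matters: the cross term [F(z) F(N)] has no sign, so additivity of the integral
   on the right-hand side needs integrability. *)
have [Joo|Joo] := eqVneq J +oo%E.
  by rewrite Joo gt0_muley ?leey// lte_fin.
have Jfin : J \is a fin_num by rewrite ge0_fin_numE// ltey.
pose j x := (\int[leb]_(y in `[0%R, +oo[) ((1 + y) `^ (n + 1) * b x y ^+ 2)%:E)%E.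
have j0 x : (0 <= j x)%E.
  by apply: integral_ge0 => y _; rewrite lee_fin; exact: w0.
have mj : measurable_fun (`[0, 1[ : set (measurableTypeR R)) j.
  apply: (measurable_partial_integral (fun x y => (1 + y) `^ (n + 1) * b x y ^+ 2)) => //.
  exact: cw.
have JE : J = (\int[leb]_(x in `[0%R, 1%R[) j x)%E.
  rewrite /J /half_strip (tonelli_cts (fun x y => (1 + y) `^ (n + 1) * b x y ^+ 2))//.
  exact: cw.
have ij : (@lebesgue_measure R).-integrable `[0, 1[ j.
  apply/integrableP; split => //; under eq_integral do rewrite gee0_abs//.
  by rewrite -JE ltey.
apply: (strip_int_le_slabs _ _ (cw _ _ cF)) => // m.
set L := (X in (X <= _)%E).
have z0 : 0 <= m%:R :> R by [].
pose A := 4 * (1 + m%:R) `^ n.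
have bound N : (m <= N)%N -> (L <=
    A%:E * \int[leb]_(x in `[0%R, 1%R[) (F x m%:R * F x N%:R)%:E + 6%:E * J)%E.
  move=> mN.
  have cFF : continuous (fun x => F x m%:R * F x N%:R).
    by apply: (continuous_mul (F ^~ m%:R) (F ^~ N%:R)); exact: cts_slice_x.
  have cr : continuous (fun x => A * (F x m%:R * F x N%:R)).
    by apply: (continuous_mul (fun=> A)) => // x; exact: cvg_cst.
  rewrite JE -integralZl//; last exact: unit_integrable cFF.
  rewrite -integralZl// -integralD//=; last 2 first.
    exact: unit_integrable cr.
    exact: integrableZl.
  apply: ge0_le_integral => //=.
  + by move=> x _; apply: integral_ge0 => y _; rewrite lee_fin.
  + apply: (measurable_partial_integral (fun x y => (1 + y) `^ (n - 1) * F x y ^+ 2)) => //.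
      exact: subset_segment_ray.
    exact: cw.
  + apply: emeasurable_funD.
      by have /integrableP[] := unit_integrable _ cr.
    exact: measurable_funeM.
  + move=> x _; apply: (hardy_pointwise_infty _ _ _ _ _ _ n1 z0 _ cF cb dF).
    by rewrite ler_nat.
have lim : ((A%:E * \int[leb]_(x in `[0%R, 1%R[) (F x m%:R * F x N%:R)%:E + 6%:E * J)
    @[N --> \oo] --> (A%:E * 0 + 6%:E * J))%E.
  apply: cvgeD.
  - by rewrite mule0 fin_num_adde_defl// fin_numM.
  - by apply: cvgeZl => //; exact: decay.
  - exact: cvg_cst.
rewrite mule0 add0e in lim.
apply: (cvge_ge _ lim).
by near=> N; apply: bound; near: N; exact: nbhs_infty_ge.
Unshelve. all: by end_near. Qed.

(** * Integration by parts on the torus *)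

Lemma periodic_ibp {R : realType} (f f' g g' : R -> R) :
  (forall x : R, is_derive x 1 f (f' x)) -> (forall x : R, is_derive x 1 g (g' x)) ->
  continuous f' -> continuous g' -> f 1 = f 0 -> g 1 = g 0 ->
  (\int[leb]_(x in `[0%R, 1%R[) (f x * g' x)%:E =
   - \int[leb]_(x in `[0%R, 1%R[) (f' x * g x)%:E)%E.
Proof.
move=> df dg cf' cg' f01 g01.
have cf : continuous f by move=> x; exact: is_derive_continuous (df x).
have cg : continuous g by move=> x; exact: is_derive_continuous (dg x).
have c1 : continuous (fun x => f x * g' x).
  exact: continuous_mul.
have c2 : continuous (fun x => f' x * g x).
  exact: continuous_mul.
have cfg : continuous (fun x => f x * g x).
  exact: continuous_mul.
have c3 : continuous (fun x => f x * g' x + f' x * g x).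
  exact: (continuous_add (fun x => f x * g' x)).
have dfg (x : R) : is_derive x 1 (fun x => f x * g x) (f x * g' x + f' x * g x).
  have := is_derive_mul _ _ _ _ _ (df x) (dg x).
  by rewrite (mulrC (g x)).
have : (\int[leb]_(x in `[0%R, 1%R]) (f x * g' x + f' x * g x)%:E =
    (f 1 * g 1)%:E - (f 0 * g 0)%:E)%E.
  apply: (@continuous_FTC2 R (fun x => f x * g' x + f' x * g x)
    (fun x => f x * g x)) => //.
  - exact: continuous_subspaceT.
  - split; first by move=> x _; exact: (@ex_derive _ _ _ _ _ _ _ (dfg x)).
    + by apply: cvg_at_right_filter; exact: cfg.
    + by apply: cvg_at_left_filter; exact: cfg.
  - by move=> x _; rewrite derive1E; exact: (@derive_val _ _ _ _ _ _ _ (dfg x)).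
rewrite f01 g01 subee// -integral_itv_bndo_bndc; last first.
  apply/measurable_EFinP; apply: (measurable_funS measurableT) => //.
  exact: continuous_measurable_fun.
under eq_integral do rewrite EFinD.
rewrite integralD//=; [|exact: unit_integrable c1|exact: unit_integrable c2].
move=> /eqP.
have /fineK <- : (\int[leb]_(x in `[0%R, 1%R[) (f x * g' x)%:E)%E
    \is a fin_num by apply: integrable_fin_num => //; exact: unit_integrable c1.
have /fineK <- : (\int[leb]_(x in `[0%R, 1%R[) (f' x * g x)%:E)%E
    \is a fin_num by apply: integrable_fin_num => //; exact: unit_integrable c2.
by rewrite -EFinD -EFinN eqe addr_eq0 => /eqP ->.
Qed.

(** Smooth functions on the torus: existence of all derivatives makes each of them continuous, and
    the period 1 cancels boundary terms on [0, 1]. *)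
Definition periodic_smooth {R : realType} (f : R -> R) : Prop :=
  (forall n (x : R), derivable (derive1n n f) x 1) /\ (forall x, f (x + 1) = f x).

Lemma derive1_shift {R : realType} (f : R -> R) (a x : R) :
  derive1 (fun x => f (x + a)) x = derive1 f (x + a).
Proof.
rewrite /derive1; suff -> : (fun h : R => h^-1 *: (f (h + x + a) - f (x + a))) =
  (fun h => h^-1 *: (f (h + (x + a)) - f (x + a))) by [].
by apply/funext => h; rewrite addrA.
Qed.

Lemma derive1n_periodic {R : realType} (f : R -> R) n :
  (forall x, f (x + 1) = f x) -> forall x, derive1n n f (x + 1) = derive1n n f x.
Proof.
move=> pf; elim: n => [//|n IH] x.
rewrite !derive1nS -derive1_shift; congr (derive1 _ x).
by apply/funext.
Qed.

(** Induction on j with i free: each step moves one derivative from g to f and costs a sign, the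
    boundary terms cancelling by periodicity of all derivatives. *)
Lemma periodic_smooth_ibp {R : realType} (f g : R -> R) (i j : nat) :
  periodic_smooth f -> periodic_smooth g ->
  (\int[leb]_(x in `[0%R, 1%R[) (derive1n i f x * derive1n j g x)%:E =
   ((-1) ^+ j)%:E * \int[leb]_(x in `[0%R, 1%R[) (derive1n (i + j) f x * g x)%:E)%E.
Proof.
move=> [df pf] [dg pg].
elim: j i => [|j IH] i; first by rewrite expr0 mul1e addn0.
have D (h : R -> R) k : (forall n (x : R), derivable (derive1n n h) x 1) ->
    forall x : R, is_derive x 1 (derive1n k h) (derive1n k.+1 h x).
  by move=> dh x; exact: (is_derive_derive1 _ _ (dh k x)).
have C (h : R -> R) k : (forall n (x : R), derivable (derive1n n h) x 1) ->
    continuous (derive1n k h).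
  by move=> dh x; exact: is_derive_continuous (D _ k dh x).
have P (h : R -> R) k : (forall x, h (x + 1) = h x) -> derive1n k h 1 = derive1n k h 0 :> R.
  by move=> ph; rewrite -[in LHS](add0r (1 : R)) derive1n_periodic.
rewrite (periodic_ibp _ _ _ _ (D _ _ df) (D _ _ dg)); [|exact: C|exact: C|exact: P|exact: P].
by rewrite IH addSnnS exprS mulN1r EFinN mulNe.
Qed.

(** Once all s derivatives of [g N] are moved onto the fixed [f], only [g N] itself is left, so
    boundedness and pointwise convergence suffice: dominated convergence applies with majorant
    [M |f^(2s)|]. *)
Lemma derive1n_pairing_cvg0 {R : realType} (s : nat) (f : R -> R)
    (g : nat -> R -> R) (M : R) :
  periodic_smooth f -> (forall N, periodic_smooth (g N)) -> (forall N x, 0 <= x < 1 -> `|g N x| <= M) ->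
  (forall x, g N x @[N --> \oo] --> (0 : R)) ->
  (\int[leb]_(x in `[0%R, 1%R[) (derive1n s f x * derive1n s (g N) x)%:E)%E
    @[N --> \oo] --> 0%E.
Proof.
move=> sf sg gM g0.
have C (h : R -> R) k : periodic_smooth h -> continuous (derive1n k h).
  move=> [dh _] x; exact: is_derive_continuous (is_derive_derive1 _ _ (dh k x)).
have cg N : continuous (g N) by exact: C 0 (sg N).
have M0 : 0 <= M by apply: le_trans (gM 0 0 _); rewrite ?lexx ?ltr01.
pose h := derive1n (s + s) f.
have ch : continuous h by exact: C.
have mcont (k : R -> R) : continuous k ->
    measurable_fun (`[0, 1[ : set (measurableTypeR R)) (EFin \o k).
  move=> ck; apply/measurable_EFinP; apply: (measurable_funS measurableT) => //.
  exact: continuous_measurable_fun.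
have cvg : (\int[leb]_(x in `[0%R, 1%R[) (h x * g N x)%:E)%E @[N --> \oo] --> 0%E.
  have mI : measurable (`[0, 1[ : set (measurableTypeR R)) by [].
  have cnh : continuous (fun x => M * `|h x|).
    apply: (continuous_mul (fun=> M)); first by move=> x; exact: cvg_cst.
    by move=> x; apply: continuous_comp; [exact: ch|exact: norm_continuous].
  have [|||||_ _] := @dominated_convergence _ (measurableTypeR R) R
    (@lebesgue_measure R) `[0, 1[ mI (fun N x => (h x * g N x)%:E) (cst 0%E)
    (fun x => (M * `|h x|)%:E).
  - by move=> N; apply: mcont; exact: continuous_mul.
  - exact: measurable_cst.
  - apply: nearW => x _; apply: cvg_EFin; first exact: nearW.
    rewrite (_ : 0 = h x * 0); last by rewrite mulr0.
    by apply: cvgM; [exact: cvg_cst|exact: g0].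
  - exact: unit_integrable.
  - apply: nearW => x N /=; rewrite in_itv/= => x01.
    by rewrite lee_fin normrM mulrC ler_wpM2r// gM.
  by rewrite integral0.
have -> : (0 = ((-1) ^+ s)%:E * 0 :> \bar R)%E by rewrite mule0.
under eq_fun do rewrite periodic_smooth_ibp//.
by apply: cvgeZl => //; exact: cvg.
Qed.

(** * Smooth fields *)

Lemma cts_congr {R : realType} (f g : R -> R -> R) :
  (forall x y, 0 <= y -> f x y = g x y) -> cts f -> cts g.
Proof.
move=> fg; rewrite /cts (_ : (fun z : R * R => f z.1 `|z.2|) =
  (fun z : R * R => g z.1 `|z.2|))//.
by apply/funext => z; exact: fg.
Qed.

Lemma cts_at {R : realType} (f : R -> R -> R) (x y : R) : 0 < y -> cts f ->
  {for (x, y), continuous (fun z : R * R => f z.1 z.2)}.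
Proof.
move=> y0 /(_ (x, y)); rewrite /prop_for /continuous_at /= gtr0_norm//.
apply: cvg_trans; apply: near_eq_cvg.
exists (setT, [set b | 0 < b]) => /=.
  split; first exact: filterT.
  exact: lt_nbhsr.
by move=> [a b] [/= _ b0]; rewrite gtr0_norm.
Qed.

(** The map [(x, y) |-> (t, x, |y|)] is continuous and takes its values in [spacetime T], so
    composing with it turns continuity within that closed set into continuity of the even extension
    on the plane. *)
Lemma smooth_cts {R : realType} (T : R) (f : R -> R -> R -> R) (t : R) :
  smooth T f -> 0 <= t <= T -> cts (f t).
Proof.
move=> /(_ 0)[/= /subspace_continuousP cf _] /andP[t0 tT] [x y].
have S : spacetime T (t, x, `|y|) by split => /=.
have := cf _ S; apply: cvg_trans.
move=> P; rewrite /nbhs/= /within/= => H.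
have c : (fun z : R * R => ((t, z.1), `|z.2|)) z @[z --> (x, y)] --> ((t, x), `|y|).
  apply: (@cvg_pair _ _ _ (nbhs (x, y)) (nbhs (t, x)) (nbhs `|y|) _ _ _
    (fun z => (t, z.1)) (fun z => `|z.2|)).
    apply: (@cvg_pair _ _ _ (nbhs (x, y)) (nbhs t) (nbhs x) _ _ _
      (fun=> t) fst); first exact: cvg_cst.
    exact: cvg_fst.
  by apply: cvg_norm; exact: cvg_snd.
have := c _ H; rewrite /nbhs/=; apply: filterS => z /=; apply.
by split => /=.
Qed.

Lemma smooth_dx {R : realType} (T : R) (f : R -> R -> R -> R) :
  smooth T f -> smooth T (dx f).
Proof. by move=> sf n; have [_ [_ []]] := sf n.+1. Qed.

Lemma smooth_dy {R : realType} (T : R) (f : R -> R -> R -> R) :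
  smooth T f -> smooth T (dy f).
Proof. by move=> sf n; have [_ [_ []]] := sf n.+1. Qed.

Lemma smooth_iter_dx {R : realType} (T : R) (f : R -> R -> R -> R) k :
  smooth T f -> smooth T (iter k dx f).
Proof. by move=> sf; elim: k => [//|k IH]; exact: smooth_dx. Qed.

Lemma smooth_derivable_x {R : realType} (T : R) (f : R -> R -> R -> R) (t x y : R) :
  smooth T f -> 0 <= t <= T -> 0 <= y -> is_derive x 1 (f t ^~ y) (dx f t x y).
Proof.
move=> sf tT y0; have [_ [/(_ t x y tT y0)[_ dfx _] _]] := sf 1%N.
exact: is_derive_derive1.
Qed.

Lemma smooth_derivable_y {R : realType} (T : R) (f : R -> R -> R -> R) (t x y : R) :
  smooth T f -> 0 <= t <= T -> 0 < y -> is_derive y 1 (f t x) (dy f t x y).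
Proof.
move=> sf tT y0; have [_ [/(_ t x y tT (ltW y0))[_ _ dfy] _]] := sf 1%N.
exact: pdy_is_derive.
Qed.

Lemma dy_dx {R : realType} (T : R) (f : R -> R -> R -> R) (t x y : R) :
  smooth T f -> 0 <= t <= T -> 0 < y -> dy (dx f) t x y = dx (dy f) t x y.
Proof.
move=> sf tT y0.
(* The radius is [y] itself: the square then stays in the open half-plane, where derivatives in y
   are two-sided. *)
apply: (@mixed_derivatives_eq R (f t) (dx f t) (dy f t) (dy (dx f) t)
  (dx (dy f) t) x y y y0).
- move=> a b _; rewrite ltr_norml => /andP[yb _].
  have b0 : 0 < b by rewrite -(ltrD2r (- y)) sub0r.
  split; first by apply: smooth_derivable_x sf _ _ => //; exact: ltW.
  + exact: smooth_derivable_y sf _ _.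
  + by apply: smooth_derivable_y (smooth_dx _ _ sf) _ _.
  + by apply: smooth_derivable_x (smooth_dy _ _ sf) _ _ => //; exact: ltW.
- by apply: cts_at => //; apply: smooth_cts tT; apply: smooth_dy; exact: smooth_dx.
- by apply: cts_at => //; apply: smooth_cts tT; apply: smooth_dx; exact: smooth_dy.
Qed.

(** Through this commutation [d_y d_x^s u] becomes [d_x^s w], which makes [b] the y-derivative of
    [F]. *)
Lemma dy_iter_dx {R : realType} (T : R) (f : R -> R -> R -> R) k (t x y : R) :
  smooth T f -> 0 <= t <= T -> 0 < y ->
  dy (iter k dx f) t x y = iter k dx (dy f) t x y.
Proof.
move=> sf tT y0; elim: k x => [//|k IH] x.
rewrite !iterS (dy_dx T)//; last exact: smooth_iter_dx.
by rewrite {1 3}/dx /pdx; congr (derive1 _ x); apply/funext => a; exact: IH.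
Qed.

Lemma iter_dxE {R : realType} (f : R -> R -> R -> R) k (t x y : R) :
  iter k dx f t x y = derive1n k (f t ^~ y) x.
Proof.
elim: k x => [//|k IH] x; rewrite iterS derive1nS {1}/dx /pdx.
by congr (derive1 _ x); apply/funext.
Qed.

Lemma D0E {R : realType} (w : R -> R -> R) k (x y : R) :
  D k 0 w x y = derive1n k (w ^~ y) x.
Proof.
rewrite /D; elim: k x => [//|k IH] x; rewrite iterS derive1nS {1}/pdx.
by congr (derive1 _ x); apply/funext.
Qed.

Lemma derive1nB {R : realType} (f g : R -> R) k (x : R) :
  (forall n (x : R), derivable (derive1n n f) x 1) ->
  (forall n (x : R), derivable (derive1n n g) x 1) ->
  derive1n k (fun x => f x - g x) x = derive1n k f x - derive1n k g x.
Proof.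
move=> df dg; elim: k x => [//|k IH] x; rewrite !derive1nS.
rewrite (_ : derive1n k (fun x => f x - g x) = derive1n k f \- derive1n k g).
  by rewrite !derive1E deriveB.
by apply/funext.
Qed.

Lemma smooth_slice_x {R : realType} (T : R) (f : R -> R -> R -> R) (t y : R) :
  smooth T f -> Defs.periodic f T -> 0 <= t <= T -> 0 <= y -> periodic_smooth (f t ^~ y).
Proof.
move=> sf pf tT y0; split=> [n x|x]; last exact: pf.
have := smooth_derivable_x T _ t x y (smooth_iter_dx _ _ n sf) tT y0.
rewrite (_ : iter n dx f t ^~ y = derive1n n (f t ^~ y)); last first.
  by apply/funext => a; rewrite iter_dxE.
move=> H; exact: (@ex_derive _ _ _ _ _ _ _ H).
Qed.

Lemma periodic_smoothB {R : realType} (f g : R -> R) :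
  periodic_smooth f -> periodic_smooth g -> periodic_smooth (fun x => f x - g x).
Proof.
move=> [df pf] [dg pg]; split=> [n x|x]; last by rewrite pf pg.
rewrite (_ : derive1n n _ = derive1n n f \- derive1n n g); first exact: derivableB.
by apply/funext => a; rewrite derive1nB.
Qed.

(** * Norms as integrals over the strip *)

Lemma cts_measurable_strip {R : realType} (f : R -> R -> R) : cts f ->
  measurable_fun (half_strip : set (measurableTypeR R * measurableTypeR R))
    (fun z : R * R => (f z.1 z.2)%:E).
Proof.
by move=> cf; apply/measurable_EFinP; apply: cts_measurable.
Qed.

Lemma strip_int_ge0 {R : realType} (f : R -> R -> R) :
  (forall x y, 0 <= y -> 0 <= f x y) -> (0 <= strip_int f)%E.
Proof.
move=> f0; apply: integral_ge0 => -[x y] [/= _]; rewrite in_itv/= andbT => y0.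
by rewrite lee_fin f0.
Qed.

Lemma measurable_half_strip {R : realType} :
  measurable (half_strip : set (measurableTypeR R * measurableTypeR R)).
Proof. by apply: measurableX; exact: measurable_itv. Qed.

Lemma strip_int_le {R : realType} (f g : R -> R -> R) : cts f -> cts g ->
  (forall x y, 0 <= y -> 0 <= f x y <= g x y) -> (strip_int f <= strip_int g)%E.
Proof.
move=> cf cg fg; apply: ge0_le_integral => /=.
- exact: measurable_half_strip.
- move=> [x y] [/= _]; rewrite in_itv/= andbT => y0.
  by rewrite lee_fin; have /andP[] := fg x y y0.
- exact: cts_measurable_strip.
- exact: cts_measurable_strip.
- move=> [x y] [/= _]; rewrite in_itv/= andbT => y0.
  by rewrite lee_fin; have /andP[] := fg x y y0.
Qed.

Lemma strip_int_comb {R : realType} (a b : R) (f g : R -> R -> R) :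
  0 <= a -> 0 <= b -> cts f -> cts g ->
  (forall x y, 0 <= y -> 0 <= f x y) -> (forall x y, 0 <= y -> 0 <= g x y) ->
  (strip_int (fun x y => a * f x y + b * g x y)%R =
   a%:E * strip_int f + b%:E * strip_int g)%E.
Proof.
move=> a0 b0 cf cg f0 g0.
have pos (h : R -> R -> R) : (forall x y, 0 <= y -> 0 <= h x y) ->
    forall z : R * R, half_strip z -> (0 <= (h z.1 z.2)%:E)%E.
  move=> h0 [x y] [/= _]; rewrite in_itv/= andbT => y0.
  by rewrite lee_fin h0.
have mS := @measurable_half_strip R.
rewrite -(ge0_integralZl _ mS (cts_measurable_strip _ cf) (pos _ f0))//.
rewrite -(ge0_integralZl _ mS (cts_measurable_strip _ cg) (pos _ g0))//.
rewrite -ge0_integralD//=.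
- move=> z zS; apply: mule_ge0; [by rewrite lee_fin|exact: pos].
- apply: (cts_measurable_strip (fun x y => a * f x y)).
  exact: ctsM (cts_cst _) cf.
- move=> z zS; apply: mule_ge0; [by rewrite lee_fin|exact: pos].
- apply: (cts_measurable_strip (fun x y => b * g x y)).
  exact: ctsM (cts_cst _) cg.
Qed.

Lemma strip_intZ {R : realType} (a : R) (f : R -> R -> R) :
  0 <= a -> cts f -> (forall x y, 0 <= y -> 0 <= f x y) ->
  (strip_int (fun x y => a * f x y)%R = a%:E * strip_int f)%E.
Proof.
move=> a0 cf f0; have := strip_int_comb a 0 f f a0 (lexx _) cf cf f0 f0.
rewrite mul0e adde0 => <-; apply: eq_integral => z _.
by rewrite mul0r addr0.
Qed.

Lemma poweR_sqr {R : realType} (x : \bar R) : (0 <= x)%E -> (x `^ 2 = x ^+ 2)%E.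
Proof.
case: x => [r|_|//]; last by rewrite poweRyr ?pnatr_eq0// expe2 mulyy.
by rewrite lee_fin => r0; rewrite poweR_EFin powR_mulrn// EFin_expe.
Qed.

Lemma normLp2_sqr {R : realType} (k : R) (f : R -> R -> R) :
  (normLp 2%:E (weighted k f) ^+ 2 =
   strip_int (fun x y => (1 + y) `^ (2 * k) * f x y ^+ 2)%R)%E.
Proof.
rewrite /normLp -poweR_sqr ?Lnorm_ge0// poweR_Lnorm ?pnatr_eq0//.
rewrite [RHS]integral_mkcond; apply: eq_integral => z _.
rewrite /= !patchE; case: ifPn => [|_]; last by rewrite normr0 powR0 ?pnatr_eq0.
rewrite inE => -[_ /=]; rewrite in_itv/= andbT => z0.
rewrite powR_mulrn// real_normK ?num_real// /weighted exprMn.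
congr (_ * _)%:E; rewrite -powR_mulrn ?powR_ge0// -powRrM mulrC.
by [].
Qed.

(** The norm is an essential supremum only when the whole space has positive measure; otherwise
    every property holds almost everywhere. *)
Lemma Lnorm_oo_ae {d} {X : measurableType d} {R : realType}
    (mu : {measure set X -> \bar R}) (f : X -> \bar R) :
  {ae mu, forall x, (`|f x| <= 'N[mu]_+oo[f])%E}.
Proof.
rewrite unlock; case: ifPn => [_|]; first exact: ess_sup_ge.
rewrite -leNgt measure_le0 => /eqP mu0; exists setT; split => //.
Qed.

(** Hoelder between L^1 and L^oo. The bound [|f| <= q] is available only almost everywhere, hence
    the almost-everywhere comparison of integrals. *)
Lemma strip_int_Loo {R : realType} (rho f : R -> R -> R) (q : R) :
  cts rho -> cts f -> (forall x y, 0 <= y -> 0 <= rho x y) ->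
  normLp +oo f = q%:E ->
  (strip_int (fun x y => rho x y * f x y ^+ 2)%R <= (q ^+ 2)%:E * strip_int rho)%E.
Proof.
move=> cr cf r0 fq; have mS := @measurable_half_strip R.
have q0 : 0 <= q by rewrite -lee_fin -fq Lnorm_ge0.
have ipos z : half_strip z -> 0 <= z.2 :> R.
  by move=> [_ /=]; rewrite in_itv/= andbT.
rewrite -strip_intZ ?sqr_ge0//; apply: ae_ge0_le_integral => //=.
- by move=> z /ipos z0; rewrite lee_fin mulr_ge0 ?sqr_ge0 ?r0.
- apply: (cts_measurable_strip (fun x y => rho x y * f x y ^+ 2)).
  exact: ctsM cr (ctsX _ _ cf).
- by move=> z /ipos z0; rewrite lee_fin mulr_ge0 ?sqr_ge0 ?r0.
- apply: (cts_measurable_strip (fun x y => q ^+ 2 * rho x y)).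
  exact: ctsM (cts_cst _) cr.
have := @Lnorm_oo_ae _ _ R (@lebesgue_measure R \x @lebesgue_measure R)%E
  (EFin \o ((fun z : R * R => f z.1 z.2) \_ half_strip)).
apply: filterS => z; rewrite -/(normLp +oo f) fq /= patchE => + zS.
rewrite mem_set// lee_fin => fz; rewrite lee_fin mulrC ler_wpM2r ?r0 ?ipos//.
by rewrite -real_normK ?num_real// lerXn2r ?nnegrE.
Qed.

Lemma unit_int_Loo {R : realType} (h : R -> R) (v : R) :
  continuous h -> normLoo_torus h = v%:E ->
  (\int[leb]_(x in `[0%R, 1%R[) (h x ^+ 2)%:E <= (v ^+ 2)%:E)%E.
Proof.
move=> ch hv.
have v0 : 0 <= v by rewrite -lee_fin -hv Lnorm_ge0.
have -> : ((v ^+ 2)%:E = \int[@lebesgue_measure R]_(x in `[0%R, 1%R[) (v ^+ 2)%:E)%E.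
  rewrite integral_cst//= lebesgue_measure_itv/= lte_fin ltr01.
  by rewrite -EFinB subr0 mule1.
apply: ae_ge0_le_integral => //=.
- by move=> x _; rewrite lee_fin sqr_ge0.
- apply/measurable_EFinP; apply: measurable_funX.
  apply: (measurable_funS measurableT) => //; exact: continuous_measurable_fun.
- by move=> x _; rewrite lee_fin sqr_ge0.
have := @Lnorm_oo_ae _ _ R (@lebesgue_measure R) (EFin \o (h \_ `[0%R, 1%R[)).
apply: filterS => x; rewrite -/(normLoo_torus h) hv /= patchE => + xI.
rewrite mem_set// !lee_fin => hx.
by rewrite -real_normK ?num_real// lerXn2r ?nnegrE.
Qed.

(** * The Prandtl solution at a fixed time *)

Section fixed_time.
Context {R : realType} (eps T sigma delta : R) (U p : R -> R -> R)
  (u0 : R -> R -> R) (u v : R -> R -> R -> R).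
Hypothesis sol : prandtl_solution eps T U u0 p u v.
Hypothesis delta_gt0 : 0 < delta.
Hypothesis vorticity_ge : forall t x y : R, 0 <= t <= T -> 0 <= y ->
  delta <= (1 + y) `^ sigma * vorticity u t x y.
Variables (s : nat) (t : R).
Hypothesis tT : 0 <= t <= T.

Local Notation w := (vorticity u t).
Local Notation F := (D s 0 (fun x' y' => u t x' y' - U t x')).
Local Notation b := (D s 0 w).
Local Notation g := (good_unknown s (U t) (u t) w).

Let su := @u_smooth _ _ _ _ _ _ _ _ sol.
Let sw : smooth T (dy u) := smooth_dy _ _ su.

Lemma periodic_smooth_outer : periodic_smooth (U t).
Proof.
exact: (smooth_slice_x T (lift_tx U) t 0 (@outer_smooth _ _ _ _ _ _ _ _ sol)
  (@outer_periodic _ _ _ _ _ _ _ _ sol) tT (lexx 0)).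
Qed.

Lemma periodic_smooth_u (y : R) : 0 <= y -> periodic_smooth (u t ^~ y).
Proof. exact: smooth_slice_x su (@u_periodic _ _ _ _ _ _ _ _ sol) tT. Qed.

Lemma D_vorticityE (x y : R) : b x y = iter s dx (dy u) t x y.
Proof. by rewrite D0E iter_dxE. Qed.

Lemma defectE (x y : R) : 0 <= y -> F x y = iter s dx u t x y - derive1n s (U t) x.
Proof.
move=> y0; rewrite D0E iter_dxE derive1nB//; first by case: (periodic_smooth_u y y0).
by case: periodic_smooth_outer.
Qed.

Lemma cts_vorticity : cts w.
Proof. exact: smooth_cts sw tT. Qed.

Lemma cts_pdy_vorticity : cts (pdy w).
Proof. exact: smooth_cts (smooth_dy _ _ sw) tT. Qed.

Lemma cts_D_vorticity : cts b.
Proof.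
apply: (cts_congr (iter s dx (dy u) t)).
  by move=> x y _; rewrite D_vorticityE.
exact: smooth_cts (smooth_iter_dx _ _ s sw) tT.
Qed.

Lemma continuous_derive1n_U : continuous (derive1n s (U t)).
Proof.
by move=> x; have [/(_ s x)/is_derive_derive1/is_derive_continuous] := periodic_smooth_outer.
Qed.

Lemma cts_defect : cts F.
Proof.
apply: (cts_congr (fun x y => iter s dx u t x y - derive1n s (U t) x)).
  by move=> x y y0; rewrite defectE.
apply: ctsB; first exact: smooth_cts (smooth_iter_dx _ _ s su) tT.
by apply: cts_fst; exact: continuous_derive1n_U.
Qed.

(** [U] is independent of y, so only [d_x^s u] contributes, and the order of differentiation may be
    exchanged in the interior. *)
Lemma is_derive_defect (x y : R) : 0 < y -> is_derive y 1 (F x) (b x y).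
Proof.
move=> y0; rewrite D_vorticityE -(dy_iter_dx T)//.
have D := smooth_derivable_y _ _ _ x _ (smooth_iter_dx _ _ s su) tT y0.
have := is_derive_add _ _ _ _ _ D (is_derive_cst (- derive1n s (U t) x) y 1).
rewrite addr0; apply: near_eq_is_derive; near=> z; rewrite defectE//.
by apply: ltW; near: z; exact: lt_nbhsr.
Unshelve. all: by end_near. Qed.

Lemma is_derive_vorticity (x y : R) : 0 < y -> is_derive y 1 (w x) (pdy w x y).
Proof. exact: smooth_derivable_y sw tT. Qed.

Lemma vorticity_gt0 (x y : R) : 0 <= y -> 0 < w x y.
Proof.
move=> y0; have := lt_le_trans delta_gt0 (vorticity_ge t x y tT y0).
by rewrite pmulr_rgt0// powR_gt0// ltr_pwDl.
Qed.

Lemma vorticity_inv_le (x y : R) : 0 <= y ->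
  (w x y)^-1 ^+ 2 <= (delta ^+ 2)^-1 * (1 + y) `^ (2 * sigma).
Proof.
move=> y0; have w0 := vorticity_gt0 x y y0.
have -> : (1 + y) `^ (2 * sigma) = ((1 + y) `^ sigma) ^+ 2.
  by rewrite -powR_mulrn ?powR_ge0// -powRrM mulrC.
rewrite -exprVn -exprMn; apply: lerXn2r; rewrite ?nnegrE.
- by rewrite invr_ge0 ltW.
- by rewrite mulr_ge0 ?powR_ge0// invr_ge0 ltW.
rewrite -(ler_pM2l delta_gt0) mulrA divff ?gt_eqF// mul1r.
by rewrite ler_pdivrMr//; exact: vorticity_ge.
Qed.

Lemma u_nondecreasing (x y y' : R) : 0 <= y -> y <= y' -> u t x y <= u t x y'.
Proof.
move=> y0; rewrite le_eqVlt => /predU1P[->//|yy'].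
have cu := cts_slice_y (u t) x (smooth_cts _ _ _ su tT).
have y'0 : 0 < y' by exact: le_lt_trans yy'.
(* The even extension is used because [y] may be 0, where [u] is only controlled from inside the
   half-plane. *)
have C : {within `[y, y'], continuous (fun y : R => u t x `|y|)}.
  exact: continuous_subspaceT.
have dU z : z \in `]y, y'[%R -> is_derive z 1 (fun y : R => u t x `|y|) (w x z).
  rewrite in_itv/= => /andP[yz _].
  have z0 : 0 < z by exact: le_lt_trans yz.
  have := smooth_derivable_y _ _ _ x _ su tT z0.
  apply: near_eq_is_derive.
  near=> a; rewrite gtr0_norm//; near: a; exact: lt_nbhsr.
have [c] := MVT yy' dU C.
rewrite in_itv/= => /andP[yc _].
rewrite (ger0_norm y0) (gtr0_norm y'0) => E.
rewrite -subr_ge0 E mulr_ge0 ?subr_ge0 1?ltW//.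
by rewrite vorticity_gt0// (le_trans y0)// ltW.
Unshelve. all: by end_near. Qed.

Lemma u_ge0 (x y : R) : 0 <= y -> 0 <= u t x y.
Proof.
move=> y0; rewrite -(@u_no_slip _ _ _ _ _ _ _ _ sol t x tT).
exact: u_nondecreasing.
Qed.

Lemma u_le_outer (x y : R) : 0 <= y -> u t x y <= U t x.
Proof.
move=> y0.
apply: (cvgr_to_ge (@u_far_field _ _ _ _ _ _ _ _ sol t x tT)).
near=> z; apply: u_nondecreasing => //; near: z; exact: nbhs_pinfty_ge.
Unshelve. all: by end_near. Qed.

Lemma defect_pairing_cvg0 (z : R) : 0 <= z ->
  (\int[leb]_(x in `[0%R, 1%R[) (F x z * F x N%:R)%:E)%E @[N --> \oo] --> 0%E.
Proof.
move=> z0.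
pose f (y x : R) := u t x y - U t x.
have sf y : 0 <= y -> periodic_smooth (f y).
  by move=> y0; apply: periodic_smoothB; [exact: periodic_smooth_u|exact: periodic_smooth_outer].
have cU : continuous (U t).
  by move=> x; have [/(_ 0 x)/is_derive_derive1/is_derive_continuous] := periodic_smooth_outer.
(* The maximum of [U] over a period is the uniform bound: [|u - U| = U - u <= U], since [u]
   increases in y from 0 to [U]. *)
have [c _ cmax] := @EVT_max R (U t) 0 1 ler01 (continuous_subspaceT cU).
under eq_fun do under eq_integral do rewrite !D0E.
apply: (@derive1n_pairing_cvg0 R s (f z) (fun N => f N%:R) (U t c)).
- exact: sf.
- by move=> N; exact: sf.
- move=> N x /andP[x0 x1]; rewrite /f distrC ger0_norm ?subr_ge0 ?u_le_outer//.
  rewrite (@le_trans _ _ (U t x))//; first by rewrite gerBl u_ge0.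
  by apply: cmax; rewrite in_itv/= x0 ltW.
- move=> x; rewrite -(subrr (U t x)); apply: cvgB; last exact: cvg_cst.
  apply: (cvg_comp _ _ (@cvgr_idn R)).
  exact: (@u_far_field _ _ _ _ _ _ _ _ sol t x tT).
Qed.

Lemma defect_wall (x : R) : F x 0 = - derive1n s (U t) x.
Proof.
rewrite defectE// iter_dxE (_ : u t ^~ 0 = cst 0).
  suff -> : derive1n s (cst 0 : R -> R) x = 0 by rewrite sub0r.
  elim: s x => [//|k IH] x; rewrite derive1nS (_ : derive1n k _ = cst 0).
    by rewrite derive1_cst.
  by apply/funext.
by apply/funext => a; exact: @u_no_slip _ _ _ _ _ _ _ _ sol t a tT.
Qed.

End fixed_time.

Lemma weightD {R : realType} (k l y : R) : 0 <= y ->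
  (1 + y) `^ (k + l) = (1 + y) `^ k * (1 + y) `^ l.
Proof.
move=> y0; have Y : 0 < 1 + y by rewrite ltr_pwDl.
by rewrite powRD ?(gt_eqF Y) ?implybT.
Qed.

Lemma weight_sqr {R : realType} (k y : R) :
  ((1 + y) `^ k) ^+ 2 = (1 + y) `^ (2 * k).
Proof. by rewrite -powR_mulrn ?powR_ge0// -powRrM mulrC. Qed.

Lemma cts_weighted {R : realType} (k : R) (f : R -> R -> R) :
  cts f -> cts (weighted k f).
Proof. by move=> cf; exact: ctsM (cts_weight k) cf. Qed.

Lemma cts_weighted_sqr {R : realType} (k : R) (f : R -> R -> R) :
  cts f -> cts (fun x y => (1 + y) `^ k * f x y ^+ 2).
Proof. by move=> cf; exact: ctsM (cts_weight k) (ctsX 2 _ cf). Qed.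

Lemma weighted_sqr_ge0 {R : realType} (k : R) (f : R -> R -> R) (x y : R) :
  0 <= (1 + y) `^ k * f x y ^+ 2.
Proof. by rewrite mulr_ge0 ?powR_ge0 ?sqr_ge0. Qed.

(** * Comparison of [d_x^s w] and the good unknown at a fixed time *)

Section fixed_time_bounds.
Context {R : realType} (eps T gamma sigma delta : R) (U p : R -> R -> R)
  (u0 : R -> R -> R) (u v : R -> R -> R -> R).
Hypothesis sol : prandtl_solution eps T U u0 p u v.
Hypothesis delta_gt0 : 0 < delta.
Hypothesis gamma_ge1 : 1 <= gamma.
Hypothesis sigma_ge : gamma + 2^-1 <= sigma.
Hypothesis vorticity_ge : forall t x y : R, 0 <= t <= T -> 0 <= y ->
  delta <= (1 + y) `^ sigma * vorticity u t x y.
Variables (s : nat) (t : R).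
Hypothesis tT : 0 <= t <= T.

Local Notation w := (vorticity u t).
Local Notation F := (D s 0 (fun x' y' => u t x' y' - U t x')).
Local Notation b := (D s 0 w).
Local Notation g := (good_unknown s (U t) (u t) w).
Local Notation Xf := (fun x y => (1 + y) `^ (2 * gamma) * b x y ^+ 2).
Local Notation Gf := (fun x y => (1 + y) `^ (2 * gamma) * g x y ^+ 2).
Local Notation X := (strip_int Xf).
Local Notation G := (strip_int Gf).
Local Notation wy := (weighted (sigma + 1) (pdy w)).

Let cw : cts w := cts_vorticity _ _ _ _ _ _ _ sol t tT.
Let cwy : cts (pdy w) := cts_pdy_vorticity _ _ _ _ _ _ _ sol t tT.
Let cF : cts F := cts_defect _ _ _ _ _ _ _ sol s t tT.
Let cb : cts b := cts_D_vorticity _ _ _ _ _ _ _ sol s t tT.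
Let w_gt0 x y (y0 : 0 <= y) : 0 < w x y :=
  vorticity_gt0 _ _ _ _ delta_gt0 vorticity_ge t tT x y y0.
Let w_neq0 x y (y0 : 0 <= y) : w x y != 0.
Proof. by rewrite gt_eqF// w_gt0. Qed.
Let cg : cts g.
Proof.
apply: ctsB => //; apply: ctsM => //; apply: ctsM => //; exact: ctsV.
Qed.
Let winv x y (y0 : 0 <= y) :=
  vorticity_inv_le _ _ _ _ delta_gt0 vorticity_ge t tT x y y0.

(** The factor [1/w] costs [(1 + y)^sigma / delta], and [w_y] pays back [q (1 + y)^(-sigma-1)]; the
    spare power of [1 + y] is the one that the Hardy inequality at infinity gains on [F]. *)
Lemma good_unknown_norm_le (q : R) : normLp +oo wy = q%:E ->
  (G <= 2%:E * X + (12 * (delta ^+ 2)^-1 * q ^+ 2)%:E * X)%E.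
Proof.
move=> wyq.
pose rho x y := (1 + y) `^ (2 * gamma - 1 - 1) * F x y ^+ 2.
have crho : cts rho by exact: cts_weighted_sqr.
have d0 : 0 <= (delta ^+ 2)^-1 by rewrite invr_ge0 sqr_ge0.
have n1 : 1 <= 2 * gamma - 1 by move: gamma_ge1; lra.
have hardy : (strip_int rho <= 6%:E * X)%E.
  have := @hardy_infty R (2 * gamma - 1) F b n1 cF cb
    (is_derive_defect _ _ _ _ _ _ _ sol s t tT)
    (defect_pairing_cvg0 _ _ _ _ _ _ _ _ _ sol delta_gt0 vorticity_ge s t tT).
  by rewrite subrK.
(* The bound [(b - c)^2 <= 2 b^2 + 2 c^2] with [c = (w_y / w) F]. The exponents match through
   [2 gamma = (2 gamma - 2) + 2]. The 12 of the conclusion is this 2 times the Hardy constant 6. *)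
pose dom (x y : R) :=
    2 * ((1 + y) `^ (2 * gamma) * b x y ^+ 2) +
    (2 * (delta ^+ 2)^-1) * (rho x y * wy x y ^+ 2).
have weak : (G <= strip_int dom)%E.
  apply: (@strip_int_le R Gf dom).
  - exact: cts_weighted_sqr.
  - apply: ctsD; apply: ctsM; try exact: cts_cst.
      exact: cts_weighted_sqr.
    by apply: ctsM => //; apply: ctsX; exact: cts_weighted.
  - move=> x y y0; rewrite weighted_sqr_ge0/= /dom.
    have -> : rho x y * wy x y ^+ 2 =
        (1 + y) `^ (2 * gamma) * ((1 + y) `^ (2 * sigma) * pdy w x y ^+ 2 * F x y ^+ 2).
      rewrite /rho /weighted exprMn weight_sqr.
      have E1 : (1 + y) `^ (2 * gamma) =
          (1 + y) `^ (2 * gamma - 1 - 1) * (1 + y) `^ 2.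
        by rewrite -weightD//; congr (_ `^ _); ring.
      have E2 : (1 + y) `^ (2 * (sigma + 1)) =
          (1 + y) `^ (2 * sigma) * (1 + y) `^ 2.
        by rewrite -weightD//; congr (_ `^ _); ring.
      by rewrite E1 E2; ring.
    rewrite /good_unknown.
    apply: (@le_trans _ _ ((1 + y) `^ (2 * gamma) *
      (2 * b x y ^+ 2 + 2 * (pdy w x y * F x y) ^+ 2 * (w x y)^-1 ^+ 2))).
      rewrite ler_wpM2l ?powR_ge0//.
      rewrite -subr_ge0 [leRHS](_ : _ = (b x y + pdy w x y / w x y * F x y) ^+ 2) ?sqr_ge0//.
      ring.
    rewrite -subr_ge0 [leRHS](_ : _ = (1 + y) `^ (2 * gamma) * (2 * (pdy w x y * F x y) ^+ 2 *
       ((delta ^+ 2)^-1 * (1 + y) `^ (2 * sigma) - (w x y)^-1 ^+ 2))); last by ring.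
    apply: mulr_ge0; first exact: powR_ge0.
    apply: mulr_ge0; first by rewrite mulr_ge0 ?sqr_ge0.
    by rewrite subr_ge0; exact: winv.
apply: (le_trans weak).
have Loo := strip_int_Loo rho wy q crho (cts_weighted _ _ cwy)
  (fun x y _ => weighted_sqr_ge0 _ _ x y) wyq.
rewrite [leLHS](strip_int_comb 2 (2 * (delta ^+ 2)^-1) Xf
  (fun x y => rho x y * wy x y ^+ 2))//.
- rewrite leeD2l//.
  apply: (@le_trans _ _ ((2 * (delta ^+ 2)^-1)%:E * ((q ^+ 2)%:E * (6%:E * X)))%E).
    apply: lee_wpmul2l; first by rewrite lee_fin mulr_ge0.
    apply: (le_trans Loo); apply: lee_wpmul2l => //.
    by rewrite lee_fin sqr_ge0.
  rewrite !muleA -!EFinM.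
  suff -> : 2 * (delta ^+ 2)^-1 * q ^+ 2 * 6 = 12 * (delta ^+ 2)^-1 * q ^+ 2 by [].
  by ring.
- by rewrite mulr_ge0.
- exact: cts_weighted_sqr.
- by apply: ctsM => //; apply: ctsX; exact: cts_weighted.
- by move=> x y _; exact: weighted_sqr_ge0.
- by move=> x y _; rewrite mulr_ge0 ?sqr_ge0//; exact: weighted_sqr_ge0.
Qed.

Lemma D_vorticity_norm_le (q V : R) : normLp +oo wy = q%:E ->
  normLoo_torus (derive1n s (U t)) = V%:E ->
  (X <= 2%:E * G + (2 * (delta ^+ 2)^-1 * q ^+ 2)%:E * ((V ^+ 2)%:E + G))%E.
Proof.
move=> wyq UV.
have d0 : 0 <= (delta ^+ 2)^-1 by rewrite invr_ge0 sqr_ge0.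
(* The exponent for which both weights come out as [2 gamma]: [(-m - 1) + 2 (sigma + 1)] when [h] is
   paired with [w_y], and [(1 - m) + 2 sigma] when [1/w^2] is estimated in [k = g / w]. *)
pose m := 2 * sigma - 2 * gamma + 1.
pose h x y := F x y * (w x y)^-1.
pose k x y := g x y * (w x y)^-1.
have ch : cts h by apply: ctsM => //; exact: ctsV.
have ck : cts k by apply: ctsM => //; exact: ctsV.
have dh (x y : R) : 0 < y -> is_derive y 1 (h x) (k x y).
  move=> y0; have wn0 := w_neq0 x y (ltW y0).
  have D1 := is_derive_defect _ _ _ _ _ _ _ sol s t tT x y y0.
  have D2 := is_derive_vorticity _ _ _ _ _ _ _ sol t tT x y y0.
  have D3 := is_deriveV wn0 D2.
  apply: (is_derive_eq (is_derive_mul _ _ _ _ _ D1 D3)).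
  rewrite /k /good_unknown /GRing.scale/=; field.
  exact: wn0.
pose rho x y := (1 + y) `^ (- m - 1) * h x y ^+ 2.
have crho : cts rho by exact: cts_weighted_sqr.
(* At y = 0 the no-slip condition leaves [F = - d_x^s U], and the lower bound on the vorticity has
   weight 1 there, so [1/w(x,0)^2 <= delta^-2]. *)
have wall : (\int[leb]_(x in `[0%R, 1%R[) (h x 0 ^+ 2)%:E <=
    ((delta ^+ 2)^-1 * V ^+ 2)%:E)%E.
  have cU := continuous_derive1n_U _ _ _ _ _ _ _ sol s t tT.
  have mU2 : measurable_fun (`[0, 1[ : set (measurableTypeR R))
     (fun x => (derive1n s (U t) x ^+ 2)%:E).
    apply/measurable_EFinP; apply: measurable_funX.
    apply: (measurable_funS measurableT) => //; exact: continuous_measurable_fun.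
  rewrite EFinM; apply: le_trans (lee_wpmul2l _ (unit_int_Loo _ _ cU UV)); last by rewrite lee_fin.
  rewrite -ge0_integralZl//=; last by move=> x _; rewrite lee_fin sqr_ge0.
  apply: ge0_le_integral => //=.
  - by move=> x _; rewrite lee_fin sqr_ge0.
  - apply/measurable_EFinP; apply: measurable_funX.
    apply: (measurable_funS measurableT) => //; apply: continuous_measurable_fun.
    exact: cts_slice_x.
  - exact: measurable_funeM.
  - move=> x _; rewrite -EFinM lee_fin /h (defect_wall _ _ _ _ _ _ _ sol)// exprMn sqrrN.
    rewrite mulrC ler_wpM2r ?sqr_ge0//; have := winv x 0 (lexx 0).
    by rewrite addr0 powR1 mulr1.
have tail : (strip_int (fun x y => (1 + y) `^ (1 - m) * k x y ^+ 2)%R <=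
    (delta ^+ 2)^-1%:E * G)%E.
  rewrite -[leRHS](strip_intZ _ Gf)//; [|exact: cts_weighted_sqr|by move=> x y _; exact: weighted_sqr_ge0].
  apply: (@strip_int_le R (fun x y => (1 + y) `^ (1 - m) * k x y ^+ 2)
    (fun x y => (delta ^+ 2)^-1 * Gf x y)); [exact: cts_weighted_sqr| |].
    by apply: ctsM; [exact: cts_cst|exact: cts_weighted_sqr].
  move=> x y y0; rewrite weighted_sqr_ge0/= /k exprMn.
  have -> : (1 + y) `^ (2 * gamma) = (1 + y) `^ (1 - m) * (1 + y) `^ (2 * sigma).
    by rewrite -weightD//; congr (_ `^ _); rewrite /m; ring.
  rewrite -subr_ge0 [leRHS](_ : _ = (1 + y) `^ (1 - m) * g x y ^+ 2 *
       ((delta ^+ 2)^-1 * (1 + y) `^ (2 * sigma) - (w x y)^-1 ^+ 2)); last by ring.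
  apply: mulr_ge0; first exact: weighted_sqr_ge0.
  by rewrite subr_ge0; exact: winv.
have hardy : (strip_int rho <= (delta ^+ 2)^-1%:E * ((V ^+ 2)%:E + G))%E.
  have m2 : 2 <= m by rewrite /m; move: sigma_ge; lra.
  apply: (le_trans (hardy_zero m h k m2 ch ck dh)).
  rewrite ge0_muleDr ?lee_fin ?sqr_ge0//; last first.
    by apply: (@strip_int_ge0 R Gf) => x y _; exact: weighted_sqr_ge0.
  by rewrite -EFinM; exact: leeD.
(* The bound [(g + c)^2 <= 2 g^2 + 2 c^2] with [c = w_y h]. No further [1/w] appears here, as it is
   already contained in [h]. *)
pose dom (x y : R) :=
    2 * ((1 + y) `^ (2 * gamma) * g x y ^+ 2) + 2 * (rho x y * wy x y ^+ 2).
have weak : (X <= strip_int dom)%E.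
  apply: (@strip_int_le R Xf dom).
  - exact: cts_weighted_sqr.
  - apply: ctsD; apply: ctsM; try exact: cts_cst.
      exact: cts_weighted_sqr.
    by apply: ctsM => //; apply: ctsX; exact: cts_weighted.
  - move=> x y y0; rewrite weighted_sqr_ge0/= /dom.
    have -> : rho x y * wy x y ^+ 2 =
        (1 + y) `^ (2 * gamma) * (pdy w x y * h x y) ^+ 2.
      rewrite /rho /weighted [((1 + y) `^ (sigma + 1) * _) ^+ 2]exprMn weight_sqr.
      have E1 : (1 + y) `^ (2 * gamma) =
          (1 + y) `^ (- m - 1) * (1 + y) `^ (2 * (sigma + 1)).
        by rewrite -weightD//; congr (_ `^ _); rewrite /m; ring.
      by rewrite E1; ring.
    have bE : b x y = g x y + pdy w x y * h x y.
      by rewrite /good_unknown /h; ring.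
    rewrite bE; move: (g x y) (pdy w x y * h x y) => a c.
    rewrite -subr_ge0 [leRHS](_ : _ = (1 + y) `^ (2 * gamma) * (a - c) ^+ 2).
      by rewrite mulr_ge0 ?powR_ge0 ?sqr_ge0.
    by ring.
apply: (le_trans weak).
have Loo := strip_int_Loo rho wy q crho (cts_weighted _ _ cwy)
  (fun x y _ => weighted_sqr_ge0 _ _ x y) wyq.
rewrite [leLHS](strip_int_comb 2 2 Gf (fun x y => rho x y * wy x y ^+ 2))//.
- rewrite leeD2l//.
  apply: (@le_trans _ _ (2%:E * ((q ^+ 2)%:E * ((delta ^+ 2)^-1%:E * ((V ^+ 2)%:E + G))))%E).
    apply: lee_wpmul2l => //.
    apply: (le_trans Loo); apply: lee_wpmul2l => //.
    by rewrite lee_fin sqr_ge0.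
  rewrite !muleA -!EFinM.
  suff -> : 2 * q ^+ 2 * (delta ^+ 2)^-1 = 2 * (delta ^+ 2)^-1 * q ^+ 2 by [].
  by ring.
- exact: cts_weighted_sqr.
- by apply: ctsM => //; apply: ctsX; exact: cts_weighted.
- by move=> x y _; exact: weighted_sqr_ge0.
- by move=> x y _; rewrite mulr_ge0 ?sqr_ge0//; exact: weighted_sqr_ge0.
Qed.

End fixed_time_bounds.

(** * Comparison of the two energies *)

(** The two energies share every term but the one of index (s, 0). Isolating the common remainder
    [r], possibly infinite, reduces both comparisons to one between two strip integrals. *)
Lemma Hsqr_split {R : realType} (s : nat) (gamma : R) (U : R -> R)
    (u w : R -> R -> R) : (0 < s)%N ->
  exists2 r : \bar R, (0 <= r)%E &
    (Hsqr s gamma w =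
      strip_int (fun x y => (1 + y) `^ (2 * gamma) * D s 0 w x y ^+ 2)%R + r /\
     Hgsqr s gamma U u w =
      strip_int (fun x y => (1 + y) `^ (2 * gamma) *
        good_unknown s U u w x y ^+ 2)%R + r)%E.
Proof.
move=> s0.
exists (\sum_(a : 'I_s.+1 * 'I_s.+1 | (a.1 + a.2 <= s)%N && (a.1 <= s - 1)%N)
    normLp 2%:E (weighted (gamma + a.2%:R) (D a.1 a.2 w)) ^+ 2)%E.
  by apply: sume_ge0 => a _; rewrite expe_ge0// Lnorm_ge0.
split; last by rewrite /Hgsqr normLp2_sqr.
rewrite /Hsqr (bigD1 (ord_max, ord0)) ?addn0//.
congr (_ + _)%E; first by rewrite [LHS]normLp2_sqr addr0.
(* Among pairs with [a + b <= s], differing from (s, 0) means [a <= s - 1]: [a = s] forces [b = 0],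
   and [0 < s] keeps the truncated [s - 1] below [s]. *)
apply: eq_bigl => -[a b] /=; case: leqP => //= ab.
rewrite xpair_eqE -!val_eqE/= negb_and.
have [as_|sa] := leqP a (s - 1).
  by rewrite (ltn_eqF (leq_ltn_trans as_ _))// subn1 prednK.
have sa' : (s <= a)%N by apply: leq_trans sa; rewrite subn1 prednK.
have -> : a = s :> nat by apply/eqP; rewrite eqn_leq sa' -ltnS ltn_ord.
have b0 : b = 0%N :> nat.
  apply/eqP; rewrite -leqn0 -(leq_add2l s) addn0.
  by apply: leq_trans ab; rewrite leq_add2r.
by rewrite eqxx b0.
Qed.

Lemma Q_ge0 {R : realType} (sigma : R) (w : R -> R -> R) : (0 <= Q sigma w)%E.
Proof. by apply: sume_ge0 => a _; rewrite expe_ge0// Lnorm_ge0. Qed.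

Lemma Linf_dy_le_Q {R : realType} (sigma : R) (w : R -> R -> R) :
  (normLp +oo (weighted (sigma + 1) (pdy w)) ^+ 2 <= Q sigma w)%E.
Proof.
rewrite /Q (bigD1 ((ord0 : 'I_3), (@Ordinal 3 1 isT : 'I_3)))//.
by apply: leeDl; apply: sume_ge0 => a _; rewrite expe_ge0// Lnorm_ge0.
Qed.

Lemma sqr_fin_le {R : realType} (x : \bar R) (q : R) :
  (0 <= x)%E -> (x ^+ 2 <= q%:E)%E -> exists2 r : R, x = r%:E & r ^+ 2 <= q.
Proof.
case: x => [r _|_|//]; last by rewrite expe2 mulyy leye_eq.
by rewrite -EFin_expe lee_fin; exists r.
Qed.

Lemma lee_expe2 {R : realType} (n : nat) (x y : \bar R) :
  (0 <= x)%E -> (x <= y)%E -> (x ^+ n <= y ^+ n)%E.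
Proof.
move=> x0 xy; elim: n => [|n IH]; first by rewrite !expe0.
by rewrite !expeS; apply: lee_pmul => //; exact: expe_ge0.
Qed.

Lemma le_sup_upto {R : realType} (t tau : R) (f : R -> \bar R) :
  0 <= tau <= t -> (f tau <= sup_upto t f)%E.
Proof. by move=> tt; apply: ereal_sup_ubound; exists tau. Qed.

Lemma sup_upto_le {R : realType} (t : R) (f : R -> \bar R) (M : \bar R) :
  (forall tau, 0 <= tau <= t -> (f tau <= M)%E) -> (sup_upto t f <= M)%E.
Proof. by move=> fM; apply: ge_ereal_sup => _ [tau /= tt <-]; exact: fM. Qed.

(** The arithmetic of the second inequality, with [d = delta^-2], [q] the energy [Q] and [N] the
    weighted norm of [w_y]. A finite total energy makes [N] finite, so the fixed-time estimate [H]
    is usable exactly when there is something to prove. *)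
Lemma young_good_unknown {R : realType} (d : R) (X G r q N : \bar R) :
  0 <= d -> (0 <= X)%E -> (0 <= r)%E -> (0 <= q)%E -> (0 <= N)%E ->
  (N ^+ 2 <= q)%E ->
  (forall z : R, N = z%:E -> (G <= 2%:E * X + (12 * d * z ^+ 2)%:E * X)%E) ->
  (G + r + q <= (1 + 12 * d)%:E * (1 + (X + r + q) ^+ 2))%E.
Proof.
move=> d0 X0 r0 q0 N0 Nq H.
have C0 : 0 < 1 + 12 * d by rewrite ltr_pwDl// mulr_ge0.
have [oo|noo] := eqVneq (X + r + q)%E +oo%E.
  by rewrite oo expe2 mulyy addey// gt0_muley ?leey// lte_fin.
have : (X + r + q)%E \is a fin_num by rewrite ge0_fin_numE ?ltey// !adde_ge0.
rewrite !fin_numD => /andP[/andP[/fineK XE /fineK rE] /fineK qE].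
move: X0 r0 q0 Nq H; rewrite -XE -rE -qE !lee_fin.
move: (fine X) (fine r) (fine q) => {XE rE qE noo}x r1 q1 x0 r10 q10 Nq H.
have [z Nz zq] := sqr_fin_le _ _ N0 Nq.
apply: (le_trans (leeD2r _ (leeD2r _ (H z Nz)))).
have -> : ((x%:E + r1%:E + q1%:E) ^+ 2 = ((x + r1 + q1) ^+ 2)%:E)%E.
  by rewrite EFin_expe !EFinD.
rewrite -!EFinM -!EFinD lee_fin.
have h1 : z ^+ 2 * x <= q1 * x by rewrite ler_wpM2r.
have h2 : d * (z ^+ 2 * x) <= d * (q1 * x) by rewrite ler_wpM2l.
(* With [S = x + r1 + q1] this is [d (S^2 - x q1) >= 0]; [h4] below is [2 S <= 1 + S^2], which takes
   care of the linear terms. *)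
have h3 : 0 <= d * (x ^+ 2 + (r1 + q1) ^+ 2 + x * q1 + 2 * (x * r1)).
  by rewrite mulr_ge0// !addr_ge0 ?sqr_ge0// mulr_ge0// mulr_ge0.
have h4 := sqr_ge0 (x + r1 + q1 - 1).
nra.
Qed.

(** The arithmetic of the first inequality, where [V] stands for the sup norm of [d_x^s U]. The
    constant is kept equal to that of [young_good_unknown], so that a single one serves both
    conclusions. *)
Lemma young_derivative {R : realType} (d : R) (X G r q N V : \bar R) :
  0 <= d -> (0 <= G)%E -> (0 <= r)%E -> (0 <= q)%E -> (0 <= N)%E -> (0 <= V)%E ->
  (N ^+ 2 <= q)%E ->
  (forall z v : R, N = z%:E -> V = v%:E ->
    (X <= 2%:E * G + (2 * d * z ^+ 2)%:E * ((v ^+ 2)%:E + G))%E) ->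
  (X + r + q <= (1 + 12 * d)%:E * V ^+ 4 +
    (1 + 12 * d)%:E * (1 + (G + r + q) ^+ 2))%E.
Proof.
move=> d0 G0 r0 q0 N0 V0 Nq H.
have C0 : 0 < 1 + 12 * d by rewrite ltr_pwDl// mulr_ge0.
have [oo|noo] := eqVneq (G + r + q)%E +oo%E.
  have -> : ((1 + 12 * d)%:E * (1 + (G + r + q) ^+ 2) = +oo :> \bar R)%E.
    by rewrite oo expe2 mulyy addey// gt0_muley// lte_fin.
  rewrite addey ?leey// gt_eqF// (lt_le_trans (ltNy0))//.
  by rewrite mule_ge0 ?lee_fin ?(ltW C0)// expe_ge0.
have : (G + r + q)%E \is a fin_num by rewrite ge0_fin_numE ?ltey// !adde_ge0.
rewrite !fin_numD => /andP[/andP[/fineK GE /fineK rE] /fineK qE].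
move: G0 r0 q0 Nq H; rewrite -GE -rE -qE !lee_fin.
move: (fine G) (fine r) (fine q) => {GE rE qE noo}x r1 q1 x0 r10 q10 Nq H.
have [z Nz zq] := sqr_fin_le _ _ N0 Nq.
case: V V0 H => [v v0|_|//] H; last first.
  have -> : (+oo ^+ 4 = +oo :> \bar R)%E by rewrite !expeS expe0 mule1 !mulyy.
  rewrite gt0_muley ?lte_fin// addye ?leey// gt_eqF// (lt_le_trans ltNy0)//.
apply: (le_trans (leeD2r _ (leeD2r _ (H z v Nz erefl)))).
have -> : ((x%:E + r1%:E + q1%:E) ^+ 2 = ((x + r1 + q1) ^+ 2)%:E)%E.
  by rewrite EFin_expe !EFinD.
rewrite -[(v%:E ^+ 4)%E]EFin_expe.
rewrite [leLHS](_ : _ = (2 * x + 2 * d * z ^+ 2 * (v ^+ 2 + x) + r1 + q1)%:E)//.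
rewrite [leRHS](_ : _ = ((1 + 12 * d) * v ^+ 4 +
  (1 + 12 * d) * (1 + (x + r1 + q1) ^+ 2))%:E)// lee_fin.
have h1 : d * (z ^+ 2 * (v ^+ 2 + x)) <= d * (q1 * (v ^+ 2 + x)).
  by rewrite ler_wpM2l// ler_wpM2r// addr_ge0 ?sqr_ge0.
have h2 : 0 <= d * (q1 - v ^+ 2) ^+ 2 by rewrite mulr_ge0 ?sqr_ge0.
(* The bracket is [12 S^2 - q1^2 - 2 x q1] with [S = x + r1 + q1]: what remains of [12 S^2] once
   [h2] has split [2 q1 (v^2 + x)] into [q1^2 + v^4 + 2 x q1]. *)
have h3 : 0 <= d * (12 * (x ^+ 2 + r1 ^+ 2) + 11 * q1 ^+ 2 +
    24 * (x * r1 + r1 * q1) + 22 * (x * q1)).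
  by rewrite mulr_ge0// !addr_ge0// mulr_ge0// ?addr_ge0 ?mulr_ge0 ?sqr_ge0.
have h4 := sqr_ge0 (x + r1 + q1 - 1).
have h5 : 0 <= v ^+ 4 by rewrite exprn_even_ge0.
have h6 : 0 <= d * v ^+ 4 by rewrite mulr_ge0.
nra.
Qed.

Section assembly.
Context {R : realType} (eps T gamma sigma delta : R) (U p : R -> R -> R)
  (u0 : R -> R -> R) (u v : R -> R -> R -> R).
Hypothesis sol : prandtl_solution eps T U u0 p u v.
Hypothesis delta_gt0 : 0 < delta.
Hypothesis gamma_ge1 : 1 <= gamma.
Hypothesis sigma_ge : gamma + 2^-1 <= sigma.
Hypothesis vorticity_ge : forall t x y : R, 0 <= t <= T -> 0 <= y ->
  delta <= (1 + y) `^ sigma * vorticity u t x y.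
Variables (s : nat) (t : R).
Hypothesis s_gt0 : (0 < s)%N.
Hypothesis tT : 0 <= t <= T.
Let d_ge0 : 0 <= (delta ^+ 2)^-1. Proof. by rewrite invr_ge0 sqr_ge0. Qed.

Lemma Bgsqr_le :
  (Bgsqr s gamma sigma (U t) (u t) (vorticity u t) <=
   (1 + 12 * (delta ^+ 2)^-1)%:E * (1 + Bsqr s gamma sigma (vorticity u t) ^+ 2))%E.
Proof.
have [r r0 [HE HgE]] := Hsqr_split s gamma (U t) (u t) (vorticity u t) s_gt0.
rewrite /Bgsqr /Bsqr HE HgE.
apply: young_good_unknown (Linf_dy_le_Q sigma (vorticity u t)) _ => //.
- by apply: integral_ge0 => z _; rewrite lee_fin; exact: weighted_sqr_ge0.
- exact: Q_ge0.
- exact: Lnorm_ge0.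
- move=> z wz.
  exact: (good_unknown_norm_le _ _ _ _ _ _ _ _ _ _ sol delta_gt0 gamma_ge1 vorticity_ge s t tT z wz).
Qed.

Lemma Bsqr_le :
  (Bsqr s gamma sigma (vorticity u t) <=
   (1 + 12 * (delta ^+ 2)^-1)%:E * normLoo_torus (derive1n s (U t)) ^+ 4 +
   (1 + 12 * (delta ^+ 2)^-1)%:E *
     (1 + Bgsqr s gamma sigma (U t) (u t) (vorticity u t) ^+ 2))%E.
Proof.
have [r r0 [HE HgE]] := Hsqr_split s gamma (U t) (u t) (vorticity u t) s_gt0.
rewrite /Bgsqr /Bsqr HE HgE.
apply: young_derivative (Linf_dy_le_Q sigma (vorticity u t)) _ => //.
- by apply: integral_ge0 => z _; rewrite lee_fin; exact: weighted_sqr_ge0.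
- exact: Q_ge0.
- exact: Lnorm_ge0.
- exact: Lnorm_ge0.
- move=> z V wz UV.
  exact: (D_vorticity_norm_le _ _ _ _ _ _ _ _ _ _ sol delta_gt0 sigma_ge vorticity_ge s t tT z V wz UV).
Qed.

End assembly.

Theorem lemmaB2 (R : realType) (gamma sigma delta : R)
    (hgamma : 1 <= gamma) (hsigma : gamma + 2^-1 <= sigma)
    (hdelta : 0 < delta < 1) :
  exists C : R, 0 < C /\
    forall (s : nat) (eps T : R) (U p : R -> R -> R) (u0 : R -> R -> R)
           (u v : R -> R -> R -> R),
      (4 <= s)%N -> ~~ odd s -> 0 < eps <= 1 -> 0 < T ->
      prandtl_solution eps T U u0 p u v ->
      (forall t x y : R, 0 <= t <= T -> 0 <= y ->
         delta <= (1 + y) `^ sigma * vorticity u t x y) ->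
      forall t : R, 0 <= t <= T ->
        (Omega s gamma sigma (vorticity u) t
           <= C%:E * sup_upto t (fun tau => normLoo_torus (derive1n s (U tau)) ^+ 4)
              + C%:E * (1 + Omega_g s gamma sigma U u (vorticity u) t ^+ 2))%E
        /\
        (Omega_g s gamma sigma U u (vorticity u) t
           <= C%:E * (1 + Omega s gamma sigma (vorticity u) t ^+ 2))%E.
Proof.
have /andP[delta_gt0 _] := hdelta.
have C0 : 0 < 1 + 12 * (delta ^+ 2)^-1.
  by rewrite ltr_pwDl// mulr_ge0// invr_ge0 sqr_ge0.
exists (1 + 12 * (delta ^+ 2)^-1); split => //.
move=> s eps T U p u0 u v s4 _ _ _ sol wge t /andP[t0 tT].
have s0 : (0 < s)%N by exact: leq_trans s4.
have C0' : (0 <= (1 + 12 * (delta ^+ 2)^-1)%:E)%E by rewrite lee_fin ltW.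
have tauT tau : 0 <= tau <= t -> 0 <= tau <= T.
  by move=> /andP[-> /le_trans]; apply.
(* Passing from time [tau] to the supremum uses that squaring is monotone on [0, +oo], hence the
   nonnegativity of the energies. *)
have mono (f : R -> \bar R) tau : (0 <= f tau)%E -> 0 <= tau <= t ->
    ((1 + 12 * (delta ^+ 2)^-1)%:E * (1 + f tau ^+ 2) <=
     (1 + 12 * (delta ^+ 2)^-1)%:E * (1 + sup_upto t f ^+ 2))%E.
  move=> f0 tt; apply: lee_wpmul2l => //; apply: leeD2l.
  by apply: lee_expe2 => //; exact: le_sup_upto.
split; apply: sup_upto_le => tau tt.
- apply: (le_trans (Bsqr_le _ _ _ _ _ _ _ _ _ _ sol delta_gt0 hsigma wge s _ s0 (tauT _ tt))).
  apply: leeD; last first.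
    apply: (mono (fun tau => Bgsqr s gamma sigma (U tau) (u tau) (vorticity u tau))) => //.
    by apply: adde_ge0; [apply: adde_ge0; [exact: expe_ge0 (Lnorm_ge0 _ _ _)|
      apply: sume_ge0 => a _; exact: expe_ge0 (Lnorm_ge0 _ _ _)]|exact: Q_ge0].
  apply: lee_wpmul2l => //.
  exact: (le_sup_upto t tau (fun tau => normLoo_torus (derive1n s (U tau)) ^+ 4)%E).
- apply: (le_trans (Bgsqr_le _ _ _ _ _ _ _ _ _ _ sol delta_gt0 hgamma wge s _ s0 (tauT _ tt))).
  apply: (mono (fun tau => Bsqr s gamma sigma (vorticity u tau))) => //.
  apply: adde_ge0; last exact: Q_ge0.
  by apply: sume_ge0 => a _; exact: expe_ge0 (Lnorm_ge0 _ _ _).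
Qed.
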